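(* Let $(\Omega,\Sigma,\mu)$ be a measure space, $X(\mu)$ a $\sigma$-order continuous quasi-Banach function space with the $\sigma$-property, $E$ a Banach space, $p\in(0,\infty)$, and $T\colon X(\mu)\to E$ a linear operator that is $p$-th power factorable with a continuous extension. Then $[i]\colon X(\mu)\to L^p(m_T)\cap L^1(m_T)$ is well defined, $T=I_{m_T}\circ[i]$, and $I_{m_T}\colon L^p(m_T)\cap L^1(m_T)\to E$ is $p$-th power factorable with a continuous extension. Moreover the factorization is optimal: if $\xi$ is a measure on $\Sigma$ with $\xi\ll\mu$, $Z(\xi)$ is a $\sigma$-order continuous quasi-Banach function space such that $[i]\colon X(\mu)\to Z(\xi)$ is well defined, and $S\colon Z(\xi)\to E$ is a linear operator with $T=S\circ[i]$ that is $p$-th power factorable with a continuous extension, then $[i]\colon Z(\xi)\to L^p(m_T)\cap L^1(m_T)$ is well defined and $S=I_{m_T}\circ[i]$.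
   Context: $L^0(\lambda)$: $\lambda$-a.e. classes of $\Sigma$-measurable real functions. Ideal function space: vector subspace $Y(\lambda)\subset L^0(\lambda)$ with $f\in Y(\lambda)$, $|g|\le|f|$ a.e. $\Rightarrow g\in Y(\lambda)$. Quasi-Banach function space: ideal function space complete under a quasi-norm ($\|x\|=0\iff x=0$, $\|\alpha x\|=|\alpha|\|x\|$, $\|x+y\|\le K(\|x\|+\|y\|)$, $K\ge1$) with $|f|\le|g|$ a.e. $\Rightarrow\|f\|\le\|g\|$; $\sigma$-order continuous: $f_n\downarrow0$ a.e. $\Rightarrow\|f_n\|\downarrow0$. $\sigma$-property: $\Omega=\bigcup_n\Omega_n$, $\chi_{\Omega_n}\in X(\mu)$. For a quasi-Banach function space $Y(\lambda)$: $Y(\lambda)^q=\{f:|f|^q\in Y(\lambda)\}$ with quasi-norm $\||f|^q\|_{Y(\lambda)}^{1/q}$, and $Y(\lambda)^{1/p}+Y(\lambda)$ is the set of $f=f_1+f_2$ a.e. with $f_1\in Y(\lambda)^{1/p}$, $f_2\in Y(\lambda)$, quasi-normed by $\inf(\|f_1\|_{Y(\lambda)^{1/p}}+\|f_2\|_{Y(\lambda)})$. A linear $R\colon Y(\lambda)\to E$ is $p$-th power factorable with a continuous extension if there is a continuous linear $\tilde R\colon Y(\lambda)^{1/p}+Y(\lambda)\to E$ with $\tilde R=R$ on $Y(\lambda)$. For $\xi\ll\lambda$, $[i]$ maps the $\lambda$-class of $f$ to its $\xi$-class; ''$[i]\colon Y(\lambda)\to W(\xi)$ is well defined'' means $\xi\ll\lambda$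 and the $\xi$-class of each $f\in Y(\lambda)$ lies in $W(\xi)$. $\Sigma_{X(\mu)}=\{A\in\Sigma:\chi_A\in X(\mu)\}$ ($\delta$-ring with local $\sigma$-algebra $\Sigma$), $m_T(A)=T(\chi_A)$ on $\Sigma_{X(\mu)}$ (a vector measure under the hypotheses). For a vector measure $m$ on $\Sigma_{X(\mu)}$: $|x^*m|$ the variation of $x^*\circ m$ on $\Sigma$, $\|m\|=\sup_{x^*\in B_{E^*}}|x^*m|$, $L^0(m)$ = $\Sigma$-measurable functions modulo $\|m\|$-null sets; $L^1(m)$ = those $f\in L^0(m)$ with $f\in L^1(|x^*m|)$ for all $x^*$ and, for each $A\in\Sigma$, some $\int_Af\,dm\in E$ with $x^*(\int_Af\,dm)=\int_Af\,dx^*m$ for all $x^*$, with norm $\sup_{x^*\in B_{E^*}}\int|f|d|x^*m|$; $I_m(f)=\int_\Omega f\,dm$; $L^p(m)=\{f:|f|^p\in L^1(m)\}$ with quasi-norm $\||f|^p\|_{L^1(m)}^{1/p}$; $L^p(m_T)\cap L^1(m_T)$ carries the quasi-norm $\max(\|f\|_{L^p(m_T)},\|f\|_{L^1(m_T)})$ and is regarded as a quasi-Banach function space over a measure on $\Sigma$ with the same null sets as $\|m_T\|$. *)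

(* Defs.v *)
From HB Require Import structures.
From mathcomp Require Import all_boot all_order all_algebra.
From mathcomp Require Import all_classical all_reals all_analysis.
Set Implicit Arguments. Unset Strict Implicit. Unset Printing Implicit Defensive.
Import Order.TTheory GRing.Theory Num.Theory.
Import numFieldNormedType.Exports.
Local Open Scope classical_set_scope.
Local Open Scope ring_scope.

(* Elements of L^0 are represented by Sigma-measurable functions Om -> R;
   "a.e." is taken with respect to a family N of null sets. *)
Section Defs.
Context {d : measure_display} {Om : measurableType d} {R : realType}.

Definition ae (N : set (set Om)) (P : Om -> Prop) :=
  exists A, N A /\ [set x | ~ P x] `<=` A.

Definition null_of (mu : set Om -> \bar R) : set (set Om) :=
  [set A | measurable A /\ mu A = 0%E].

Record qfs := QFS { qmem : set (Om -> R) ; qnorm : (Om -> R) -> R }.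

Definition is_qBfs (N : set (set Om)) (Y : qfs) : Prop :=
  [/\ (forall f, qmem Y f -> measurable_fun setT f),
      qmem Y (fun _ => 0),
      (forall a f g, qmem Y f -> qmem Y g -> qmem Y (fun x => a * f x + g x)),
      (forall f (g : Om -> R), qmem Y f -> measurable_fun setT g ->
          ae N (fun x => `|g x| <= `|f x|) -> qmem Y g) &
   [/\ (forall f, qmem Y f -> 0 <= qnorm Y f) /\
       (forall f, qmem Y f -> (qnorm Y f = 0 <-> ae N (fun x => f x = 0))),
       (forall a f, qmem Y f -> qnorm Y (fun x => a * f x) = `|a| * qnorm Y f),
       (exists2 K, 1 <= K & forall f g, qmem Y f -> qmem Y g ->
          qnorm Y (fun x => f x + g x) <= K * (qnorm Y f + qnorm Y g)),
       (forall f g, qmem Y f -> qmem Y g ->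
          ae N (fun x => `|f x| <= `|g x|) -> qnorm Y f <= qnorm Y g) &
       (forall u : nat -> Om -> R, (forall n, qmem Y (u n)) ->
          (forall e, 0 < e -> exists M, forall n k, (M <= n)%N -> (M <= k)%N ->
              qnorm Y (fun x => u n x - u k x) < e) ->
          exists2 f, qmem Y f &
             qnorm Y (fun x => u n x - f x) @[n --> \oo] --> 0)]].

Definition sigma_oc (N : set (set Om)) (Y : qfs) : Prop :=
  forall u : nat -> Om -> R, (forall n, qmem Y (u n)) ->
    ae N (fun x => (forall n, u n.+1 x <= u n x) /\ u n x @[n --> \oo] --> 0) ->
    qnorm Y (u n) @[n --> \oo] --> 0.

Definition sigma_prop (Y : qfs) : Prop :=
  exists O : nat -> set Om, (forall n, measurable (O n)) /\
    \bigcup_n O n = setT /\ forall n, qmem Y (\1_(O n)).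

Definition qpow (Y : qfs) (q : R) : qfs :=
  QFS (fun f => measurable_fun setT f /\ qmem Y (fun x => `|f x| `^ q))
      (fun f => qnorm Y (fun x => `|f x| `^ q) `^ q^-1).

Definition qsum (N : set (set Om)) (Y1 Y2 : qfs) : qfs :=
  QFS (fun f => measurable_fun setT f /\ exists f1 f2, qmem Y1 f1 /\ qmem Y2 f2 /\
                 ae N (fun x => f x = f1 x + f2 x))
      (fun f => inf [set r | exists f1 f2, [/\ qmem Y1 f1, qmem Y2 f2,
                 ae N (fun x => f x = f1 x + f2 x) & r = qnorm Y1 f1 + qnorm Y2 f2]]).

Context {E : normedModType R}.

Definition lin_op (N : set (set Om)) (V : set (Om -> R)) (S : (Om -> R) -> E) :=
  (forall a f g, V f -> V g -> S (fun x => a * f x + g x) = a *: S f + S g) /\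
  (forall f g, V f -> V g -> ae N (fun x => f x = g x) -> S f = S g).

Definition cont_on (Y : qfs) (S : (Om -> R) -> E) :=
  forall g, qmem Y g -> forall e, 0 < e -> exists2 del, 0 < del &
    forall f, qmem Y f -> qnorm Y (fun x => f x - g x) < del -> `|S f - S g| < e.

Definition pfact (N : set (set Om)) (Y : qfs) (p : R) (S : (Om -> R) -> E) :=
  exists St : (Om -> R) -> E,
    [/\ lin_op N (qmem (qsum N (qpow Y p^-1) Y)) St,
        cont_on (qsum N (qpow Y p^-1) Y) St &
        forall f, qmem Y f -> St f = S f].

Definition wd (N1 : set (set Om)) (Y : qfs) (N2 : set (set Om)) (W : qfs) :=
  (forall A, N1 A -> N2 A) /\ (forall f, qmem Y f -> qmem W f).

Definition dualB : set (E -> R) :=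
  [set xs | (forall a u v, xs (a *: u + v) = a * xs u + xs v) /\
            forall v, `|xs v| <= `|v|].

Definition SigmaX (Y : qfs) : set (set Om) :=
  [set A | measurable A /\ qmem Y (\1_A)].

Definition mT (Y : qfs) (S : (Om -> R) -> E) (A : set Om) : E := S (\1_A).

Definition var (D : set (set Om)) (nu : set Om -> R) (A : set Om) : \bar R :=
  ereal_sup [set r | exists (n : nat) (B : 'I_n -> set Om),
     [/\ (forall i, D (B i) /\ B i `<=` A),
         (forall i j, i != j -> B i `&` B j = set0) &
         r = ((\sum_(i < n) `|nu (B i)|)%:E)]].

Definition pvar (D : set (set Om)) (nu : set Om -> R) (A : set Om) : \bar R :=
  ereal_sup [set (nu B)%:E | B in [set B | D B /\ B `<=` A]].

(* int_A f d nu  (Jordan decomposition) *)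
Definition sint (D : set (set Om)) (nu : set Om -> R) (A : set Om) (f : Om -> R) : R :=
  fine (\int[pvar D nu]_(x in A) (f x)%:E) -
  fine (\int[pvar D (fun B => - nu B)]_(x in A) (f x)%:E).

Definition mnull (D : set (set Om)) (m : set Om -> E) : set (set Om) :=
  [set A | measurable A /\ forall xs, dualB xs -> var D (xs \o m) A = 0%E].

Definition inL1 (D : set (set Om)) (m : set Om -> E) (f : Om -> R) : Prop :=
  [/\ measurable_fun setT f,
      (forall xs, dualB xs -> (\int[var D (xs \o m)]_x (`|f x|)%:E < +oo)%E) &
      forall A, measurable A -> exists e : E,
        forall xs, dualB xs -> xs e = sint D (xs \o m) A f].

Definition nL1 (D : set (set Om)) (m : set Om -> E) (f : Om -> R) : R :=
  sup [set fine (\int[var D (xs \o m)]_x (`|f x|)%:E) | xs in dualB].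

Definition Iint (D : set (set Om)) (m : set Om -> E) (f : Om -> R) : E :=
  xget 0 [set e | forall xs, dualB xs -> xs e = sint D (xs \o m) setT f].

Definition LpL1 (D : set (set Om)) (m : set Om -> E) (p : R) : qfs :=
  QFS (fun f => (measurable_fun setT f /\ inL1 D m (fun x => `|f x| `^ p)) /\
                inL1 D m f)
      (fun f => Num.max (nL1 D m (fun x => `|f x| `^ p) `^ p^-1) (nL1 D m f)).

End Defs.

(* Main.v *)
Require Import Defs.
From HB Require Import structures.
From mathcomp Require Import all_boot all_order all_algebra.
From mathcomp Require Import all_classical all_reals all_analysis.
From mathcomp Require Import ring lra measurable_realfun.
Import Order.TTheory GRing.Theory Num.Theory.
Import numFieldNormedType.Exports HBNNSimple.
Local Open Scope classical_set_scope.
Local Open Scope ring_scope.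

(** Fix a functional x* in the dual ball and let nu = x* o m_T, with Hahn set B.
    Since nu(A) is the value of x* o T at the indicator of A, approximating
    0 <= f in X from below by simple functions supported on sets of Sigma_X and
    using sigma-order continuity gives that the integral of f against the positive
    part of nu is x*(T(f 1_B)); hence the integral of f 1_A against nu is
    x*(T(f 1_A)), so f is in L^1(m_T) with integral T f.  The argument only needs an
    ideal of functions on which an order continuous operator extends m_T: applied to
    the extension of S on Z and on Z^{1/p}, it shows that f and |f|^p lie in
    L^1(m_T) for every f in Z and that S f is the integral of f; the case Z = X is
    the factorization of T.

    Conversely L^p cap L^1 + (L^p cap L^1)^{1/p} is contained in L^1(m_T), on which
    the integration operator is bounded by the norm.  This uses that the dual ball is
    norming (Hahn-Banach), that the norm of L^1(m_T) is finite (uniform boundedness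
    applied to the indefinite integral), and that L^1(m_T) is an ideal. *)

(** * Hahn-Banach and uniform boundedness for the dual ball *)

Section HahnBanach.
Context {R : realType} {E : normedModType R}.
Implicit Types (q : E -> R) (u v w : E).

Definition sublinear q : Prop :=
  (forall u v, q (u + v) <= q u + q v) /\
  (forall (a : R) v, 0 <= a -> q (a *: v) = a * q v).

Lemma sublinear0 q : sublinear q -> q 0 = 0.
Proof. by move=> [_ /(_ 0 0 (lexx _))]; rewrite scale0r mul0r. Qed.

Lemma sublinear_ge q u : sublinear q -> - q (- u) <= q u.
Proof.
move=> sq; have := sq.1 u (- u); rewrite subrr (sublinear0 _ sq); lra.
Qed.

(** The auxiliary functional of the classical Hahn-Banach argument: for sublinear [q] it lies below
    [q], and [t = 1] shows that its value at [- w] is at most [- q w]. *)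
Definition tilt q w v : R := inf [set q (v + t *: w) - t * q w | t in [set t : R | 0 <= t]].

Lemma tilt_le q w v t : sublinear q -> 0 <= t ->
  tilt q w v <= q (v + t *: w) - t * q w.
Proof.
move=> sq t0; apply: ge_inf; last by exists t.
exists (- q (- v)) => _ [s s0 <-].
have := sq.1 (v + s *: w) (- v).
rewrite addrAC subrr add0r sq.2//; lra.
Qed.

Lemma tilt_ge q w v c : sublinear q ->
  (forall t, 0 <= t -> c <= q (v + t *: w) - t * q w) -> c <= tilt q w v.
Proof.
move=> sq h; apply: lb_le_inf.
  by exists (q (v + 0 *: w) - 0 * q w), 0 => //=.
by move=> _ [t t0 <-]; exact: h.
Qed.

Lemma tilt_le_id q w v : sublinear q -> tilt q w v <= q v.
Proof.
move=> sq; apply: (le_trans (tilt_le _ _ _ _ sq (lexx 0))).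
by rewrite scale0r addr0 mul0r subr0.
Qed.

(** Subadditivity adds the parameters of two competitors. Homogeneity rescales the parameter, [t]
    becoming [b * t]; the reverse inequality is the same one for the inverse factor. *)
Lemma tilt_sublinear q w : sublinear q -> sublinear (tilt q w).
Proof.
move=> sq.
have tD u v : tilt q w (u + v) <= tilt q w u + tilt q w v.
  rewrite -lerBlDr; apply: tilt_ge => // s s0.
  rewrite lerBlDr -lerBlDl; apply: tilt_ge => // t t0.
  rewrite lerBlDr; have st : 0 <= t + s by lra.
  apply: (le_trans (tilt_le _ w _ _ sq st)).
  have := sq.1 (v + t *: w) (u + s *: w).
  rewrite addrACA -scalerDl (addrC v); lra.
split => // a v; rewrite le_eqVlt => /predU1P[<-|a0].
  rewrite scale0r mul0r; apply/eqP; rewrite eq_le; apply/andP; split.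
    by have := tilt_le_id q w 0 sq; rewrite (sublinear0 q sq).
  by apply: tilt_ge => // t t0; rewrite add0r sq.2// subrr.
have tZ b u : 0 < b -> tilt q w (b *: u) <= b * tilt q w u.
  move=> b0; rewrite -ler_pdivrMl//; apply: tilt_ge => // t t0.
  rewrite ler_pdivrMl//.
  have bt : 0 <= b * t by rewrite mulr_ge0// ltW.
  apply: (le_trans (tilt_le _ w _ _ sq bt)).
  by rewrite -scalerA -scalerDr sq.2 ?(ltW b0)// mulrBr mulrA.
apply/eqP; rewrite eq_le tZ//= -ler_pdivlMl//.
have := tZ a^-1 (a *: v); rewrite scalerA mulVf ?gt_eqF// scale1r.
by apply; rewrite invr_gt0.
Qed.

Lemma norm_sublinear : sublinear (fun v => `|v|).
Proof.
split=> [u v|a v a0]; first exact: ler_normD.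
by rewrite normrZ ger0_norm.
Qed.

(* A pointwise minimal sublinear functional is linear, since it coincides with
   its tilts. *)
Lemma sublinear_minorant q : sublinear q ->
  exists2 l : E -> R, (forall a u v, l (a *: u + v) = a * l u + l v) &
    forall v, l v <= q v.
Proof.
move=> sq.
pose T := {r : E -> R | sublinear r /\ forall v, r v <= q v}.
(* The order is reversed: a maximal element for Zorn is a pointwise minimal sublinear functional
   below [q]. *)
pose le (r s : T) : bool := `[< forall v, sval s v <= sval r v >].
have [||r s /asboolP rs /asboolP sr|A totA|[l [sl lq]] lmin] := @Zorn T le.
- by move=> r; apply/asboolP.
- move=> r s t /asboolP rs /asboolP st; apply/asboolP => v.
  exact: le_trans (st v) (rs v).
- case: r s rs sr => [r Hr] [s Hs] /= rs sr.
  have E1 : r = s by apply/funext => v; apply/eqP; rewrite eq_le rs sr.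
  by subst s; congr exist; exact: Prop_irrelevance.
- have [[r0 Ar0]|A0] := pselect (A !=set0); last first.
    exists (exist _ q (conj sq (fun v => lexx _))) => r Ar.
    by exfalso; apply: A0; exists r.
  pose i v := inf [set sval r v | r in A].
  have iA r v : A r -> i v <= sval r v.
    move=> Ar; apply: ge_inf; last by exists r.
    exists (- q (- v)) => _ [[s [ss sle]] As /=] <-.
    have := sublinear_ge s v ss; have := sle (- v); lra.
  have iG v c : (forall r, A r -> c <= sval r v) -> c <= i v.
    move=> h; apply: lb_le_inf; first by exists (sval r0 v), r0.
    by move=> _ [s As <-]; exact: h.
  have si : sublinear i.
    split.
      move=> u v; rewrite -lerBlDr; apply: (iG) => r Ar.
      rewrite lerBlDr -lerBlDl; apply: (iG) => s As.
      rewrite lerBlDr.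
      (* Here the chain property enters: the smaller of [r] and [s] can be used at both [u] and
         [v]. *)
      have [/asboolP rs|/asboolP sr] := totA _ _ Ar As.
        apply: (le_trans (iA _ _ As)).
        have := (svalP s).1.1 u v; have := rs u; lra.
      apply: (le_trans (iA _ _ Ar)).
      have := (svalP r).1.1 u v; have := sr v; lra.
    move=> a v; rewrite le_eqVlt => /predU1P[<-|a0].
      rewrite scale0r mul0r; apply/eqP; rewrite eq_le; apply/andP; split.
        by have := iA _ 0 Ar0; rewrite (sublinear0 _ (svalP r0).1).
      by apply: (iG) => r _; rewrite (sublinear0 _ (svalP r).1).
    apply/eqP; rewrite eq_le; apply/andP; split.
      rewrite -ler_pdivrMl//; apply: (iG) => r Ar; rewrite ler_pdivrMl//.
      by apply: (le_trans (iA _ _ Ar)); rewrite (svalP r).1.2// ltW.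
    apply: (iG) => r Ar; rewrite (svalP r).1.2 ?(ltW a0)// ler_pM2l//.
    exact: iA.
  have iq v : i v <= q v by apply: (le_trans (iA _ _ Ar0)); exact: (svalP r0).2.
  by exists (exist _ i (conj si iq)) => r Ar; apply/asboolP => v; exact: iA.
have lE w : tilt l w = l.
  have tq v : tilt l w v <= q v by apply: (le_trans (tilt_le_id _ _ _ sl)); exact: lq.
  apply: (congr1 sval (lmin (exist _ (tilt l w) (conj (tilt_sublinear _ w sl) tq)) _)).
  by apply/asboolP => v /=; exact: tilt_le_id.
have lD u v : l (u + v) = l u + l v.
  apply/eqP; rewrite eq_le sl.1/=.
  (* At parameter 1 the bound on the tilt, which is [l] itself, is superadditivity:
     [l u <= l (u + v) - l v]. *)
  have := tilt_le l v u 1 sl ler01; rewrite lE scale1r mul1r; lra.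
have lN v : l (- v) = - l v.
  by apply/eqP; rewrite -subr_eq0 opprK -lD addNr sublinear0.
exists l => // a u v; rewrite lD; congr (_ + _).
have [a0|a0] := leP 0 a; first exact: sl.2.
rewrite -[a]opprK scaleNr lN sl.2 ?mulNr//; lra.
Qed.

(** A linear minorant [l] of the tilt of the norm along [v] satisfies [l (- v) <= - norm v], while
    [l] stays below the norm. *)
Lemma dualB_norming v : exists2 xs, @dualB R E xs & xs v = `|v|.
Proof.
have sn := norm_sublinear; have st := tilt_sublinear _ v sn.
have [l lL lt] := sublinear_minorant _ st.
have l0 : l 0 = 0 by have := lL 1 0 0; rewrite scaler0 addr0 mul1r; lra.
have lN u : l (- u) = - l u.
  by have := lL (-1) u 0; rewrite !addr0 scaleN1r l0; lra.
have ln u : l u <= `|u| := le_trans (lt u) (tilt_le_id _ _ _ sn).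
exists l; first split => // u.
  by rewrite ler_norml ln andbT; have := ln (- u); rewrite lN normrN; lra.
apply/eqP; rewrite eq_le ln/=.
have := tilt_le _ v (- v) 1 sn ler01; have := lt (- v).
rewrite scale1r addNr normr0 lN mul1r; lra.
Qed.

Lemma dualB_separates u v :
  (forall xs, @dualB R E xs -> xs u = xs v) -> u = v.
Proof.
move=> h; apply/eqP; rewrite -subr_eq0 -normr_le0.
have [xs xsB <-] := dualB_norming (u - v).
by rewrite -scaleN1r addrC xsB.1 (h _ xsB) mulN1r addNr.
Qed.

Lemma norm_le_dualB v c :
  (forall xs, @dualB R E xs -> xs v <= c) -> `|v| <= c.
Proof. by move=> h; have [xs xsB <-] := dualB_norming v; exact: h. Qed.

End HahnBanach.

(** * Uniform boundedness over the dual ball *)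

Section UniformBoundedness.
Context {R : realType} {E : normedModType R}.

(* Gliding hump: along a sequence e_n of F with very large norms, move from x_n
   to x_n+1 = x_n +- y_n / 3^n+1 with y_n norming e_n and the sign chosen so that
   |x_n+1 e_n| >= |e_n| / 3^n+1; the later steps are too small to undo this. *)
Lemma dualB_bounded (F : set E) :
  (forall xs, dualB xs -> exists M : R, forall e, F e -> `|xs e| <= M) ->
  exists M : R, forall e, F e -> `|e| <= M.
Proof.
move=> wb; apply: contrapT => nb.
(* [c n] is the sum of 3^-k over k > n. Hence the step leading to [x n.+1] has size
   [2 * c n.+1 = c n - c n.+1], and all steps after [x n] together move it by at most [c n]. *)
pose c n : R := 3^-1 ^+ n / 2.
have c0 n : 0 < c n by rewrite divr_gt0// exprn_gt0// invr_gt0.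
have cS n : c n = 3 * c n.+1 by rewrite /c exprS; field.
have cle n m : (n <= m)%N -> c m <= c n.
  move=> nm; rewrite -(subnKC nm); elim: (m - n)%N => [|k IH]; first by rewrite addn0.
  by apply: le_trans IH; rewrite addnS (cS (n + k)%N); have := c0 (n + k).+1; lra.
have ccvg : c n @[n --> \oo] --> (0 : R).
  rewrite -[0](mul0r (2^-1 : R)); apply: cvgMl.
  by apply: cvg_expr; rewrite ger0_norm ?invr_ge0// invf_lt1// ltr1n.
have /choice[e eP] : forall n, exists e, F e /\ n%:R <= c n.+1 * `|e|.
  move=> n.
  apply: contrapT => ne; apply: nb; exists (n%:R / c n.+1) => e Fe.
  rewrite leNgt; apply/negP => lte; apply: ne; exists e; split=> //.
  by move: lte; rewrite ltr_pdivrMr// mulrC => /ltW.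
have /choice[y yP] : forall n, exists y : E -> R, dualB y /\ y (e n) = `|e n|.
  move=> n.
  by have [l lB ln] := dualB_norming (e n); exists l.
pose step n (x : E -> R) (s : R) v := x v + s * (2 * c n.+1 * y n v).
pose next n x := if 2 * c n.+1 * `|e n| <= `|step n x 1 (e n)|
                 then step n x 1 else step n x (-1).
pose x := fix x n : E -> R := if n is k.+1 then next k (x k) else fun=> 0.
have xS n v : exists2 s, `|s| <= 1 & x n.+1 v = x n v + s * (2 * c n.+1 * y n v).
  rewrite /= /next; case: ifP => _; [exists 1|exists (-1)] => //;
  by rewrite ?normrN normr1.
have xlin n a u v : x n (a *: u + v) = a * x n u + x n v.
  elim: n a u v => [|n IH] a u v; first by rewrite /= mulr0 addr0.
  by rewrite /= /next; case: ifP => _; rewrite /step IH (yP n).1.1; ring.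
(* For b >= 0, one of a + b and a - b has absolute value at least b; [next] chooses the sign
   accordingly. *)
have xe n : 2 * c n.+1 * `|e n| <= `|x n.+1 (e n)|.
  rewrite /= /next; case: ifPn => //; rewrite -ltNge /step (yP n).2.
  have := c0 n.+1; have := normr_ge0 (e n).
  set b := 2 * _ * _; set a := x n _ => ? ?.
  have : 0 <= b by rewrite /b; nra.
  rewrite mul1r mulN1r => b0; rewrite ltr_norml => /andP[_ ab].
  by rewrite distrC; apply: le_trans (ler_norm (b - a)); lra.
have yn n v : `|2 * c n.+1 * y n v| <= (c n - c n.+1) * `|v|.
  rewrite normrM gtr0_norm ?mulr_gt0// (_ : c n - c n.+1 = 2 * c n.+1); last by rewrite (cS n); ring.
  by rewrite ler_pM2l ?mulr_gt0//; exact: (yP n).1.2.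
have xnext n v : `|x n.+1 v - x n v| <= (c n - c n.+1) * `|v|.
  have [s s1 ->] := xS n v; rewrite addrAC subrr add0r normrM.
  by apply: le_trans (yn n v); rewrite ler_piMl.
have xnm n m v : (n <= m)%N -> `|x m v - x n v| <= (c n - c m) * `|v|.
  move=> nm; rewrite -(subnKC nm); elim: (m - n)%N => [|k IH].
    by rewrite addn0 !subrr normr0 mul0r.
  rewrite addnS; have := ler_normD (x (n + k).+1 v - x (n + k)%N v) (x (n + k)%N v - x n v).
  rewrite addrA subrK => /le_trans; apply.
  by have := xnext (n + k)%N v; rewrite !mulrBl in IH *; lra.
(* Adding [c n] times the norm of [v] makes the sequence nonincreasing, by [xnext], so that monotone
   convergence applies. *)
have xc v : cvgn (fun n => x n v).
  have : cvgn (fun n => (x n v + c n * `|v|) - c n * `|v|).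
    apply: is_cvgB; last by apply: is_cvgMl; exact: cvgP ccvg.
    apply: nonincreasing_is_cvgn.
      apply/nonincreasing_seqP => n.
      by have := xnext n v; rewrite mulrBl ler_norml => /andP[_]; lra.
    exists (- (c 0%N * `|v|)) => _ [n _ <-].
    have := xnm 0%N n v (leq0n _); rewrite /= subr0 mulrBl ler_norml => /andP[+ _].
    by have := mulr_ge0 (ltW (c0 n)) (normr_ge0 v); lra.
  by under eq_fun do rewrite addrK.
pose l v := limn (fun n => x n v).
have lP v : x n v @[n --> \oo] --> l v by exact: xc.
have lxn n v : `|l v - x n v| <= c n * `|v|.
  have dl : `|x m v - x n v| @[m --> \oo] --> `|l v - x n v|.
    by apply: cvg_norm; apply: cvgB => //; exact: cvg_cst.
  apply: (cvgr_to_le dl).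
  near=> m; apply: (le_trans (xnm n m v _)); first by near: m; exact: nbhs_infty_ge.
  by rewrite ler_wpM2r// gerBl ltW.
have lB : dualB l.
  split=> [a u v|v].
    apply: cvg_lim => //; rewrite [X in X @ _](_ : _ = fun n => a * x n u + x n v).
      by apply: cvgD => //; apply: cvgMr.
    by apply/funext => n.
  have := lxn 0%N v; rewrite /= subr0 => /le_trans; apply.
  rewrite /c expr0 -[leRHS]mul1r ler_wpM2r//; lra.
have [M Mb] := wb _ lB.
pose n := Num.bound `|M|.
have Mn : M < n%:R := le_lt_trans (ler_norm M) (archi_boundP (normr_ge0 M)).
(* At [e n] the iterate [x n.+1] has size at least twice [c n.+1 * norm (e n)] and [l] differs from
   it by at most once that quantity, which is at least [n > M]. *)
have := Mb _ (eP n).1; have := lxn n.+1 (e n); have := xe n; have := (eP n).2.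
have := ler_distD (l (e n)) (x n.+1 (e n)) 0; rewrite !subr0 distrC; lra.
Unshelve. all: by end_near.
Qed.
End UniformBoundedness.

(** * Variations of a signed set function on a covering ring *)

Section Variation.
Context {d : measure_display} {Om : measurableType d} {R : realType}.
Implicit Types (D : set (set Om)) (nu : set Om -> R) (A B : set Om).

(** What is used of [SigmaX X]: an ideal of measurable sets, hence a delta-ring, exhausted by an
    increasing sequence of its members. *)
Definition covering_ring D : Prop :=
  [/\ (forall A, D A -> measurable A),
      (forall A B, D A -> measurable B -> B `<=` A -> D B),
      (forall A B, D A -> D B -> D (A `|` B)) &
      exists O : nat -> set Om, [/\ forall n, D (O n),
        forall n, O n `<=` O n.+1 & \bigcup_n O n = setT]].

(** Countable additivity is phrased as finite additivity plus continuity at the empty set, the form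
    that order continuity of an operator yields directly. *)
Definition countably_additive D nu : Prop :=
  (forall A B, D A -> D B -> A `&` B = set0 -> nu (A `|` B) = nu A + nu B) /\
  (forall F : nat -> set Om, (forall n, D (F n)) -> (forall n, F n.+1 `<=` F n) ->
     \bigcap_n F n = set0 -> nu (F n) @[n --> \oo] --> 0).

Lemma countably_additiveN D nu :
  countably_additive D nu -> countably_additive D (fun A => - nu A).
Proof.
move=> [nuD nu0]; split=> [A B DA DB AB|F DF FS F0].
  by rewrite nuD// opprD.
by rewrite -oppr0; apply: cvgN; exact: nu0.
Qed.

Lemma ereal_supD_le (I : Type) (P Q : set I) (f g : I -> R) (z : \bar R) :
  P !=set0 -> Q !=set0 -> (forall i j, P i -> Q j -> ((f i + g j)%:E <= z)%E) ->
  (ereal_sup [set (f i)%:E | i in P] + ereal_sup [set (g j)%:E | j in Q] <= z)%E.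
Proof.
move=> [i0 Pi0] [j0 Qj0] h.
set b := ereal_sup [set (g j)%:E | j in Q].
have gb : ((g j0)%:E <= b)%E by apply: ereal_sup_ubound; exists j0.
have fb i : P i -> ((f i)%:E + b <= z)%E.
  move=> Pi; rewrite -leeBrDl//; apply: ge_ereal_sup => _ [j Qj <-].
  by rewrite leeBrDl// -EFinD h.
case: b gb fb => [b _ fb|_ fb|//].
  rewrite -leeBrDr//; apply: ge_ereal_sup => _ [i Pi <-].
  by rewrite leeBrDr// fb.
have := fb _ Pi0; rewrite addey// leye_eq => /eqP ->; exact: leey.
Qed.

Section CoveringRing.
Variable D : set (set Om).
Hypothesis cD : covering_ring D.

Let Dm A : D A -> measurable A. Proof. by case: cD => [h _ _ _]; exact: h. Qed.
Let Dsub A B : D A -> measurable B -> B `<=` A -> D B.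
Proof. by case: cD => [_ h _ _]; exact: h. Qed.
Let DU A B : D A -> D B -> D (A `|` B).
Proof. by case: cD => [_ _ h _]; exact: h. Qed.

Lemma covering_ring0 : D set0.
Proof. by case: cD => [_ h _ [K [DK _ _]]]; exact: (h (K 0%N)). Qed.

Let D0 := covering_ring0.

Lemma covering_ringI A B : D A -> measurable B -> D (A `&` B).
Proof.
by move=> DA mB; apply: (Dsub A) => //; apply: measurableI => //; exact: Dm.
Qed.

Lemma covering_ringD A B : D A -> measurable B -> D (A `\` B).
Proof.
by move=> DA mB; apply: (Dsub A) => //; apply: measurableD => //; exact: Dm.
Qed.

Section Signed.
Variable nu : set Om -> R.
Hypothesis snu : countably_additive D nu.

Lemma countably_additive0 : nu set0 = 0.
Proof.
by have := snu.1 set0 set0 D0 D0 (set0I _); rewrite setU0; lra.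
Qed.

Lemma countably_additive_split A B : D A -> measurable B ->
  nu A = nu (A `&` B) + nu (A `\` B).
Proof.
move=> DA mB; rewrite -snu.1; first by rewrite setUIDK.
- exact: covering_ringI.
- exact: covering_ringD.
- by rewrite setDE setIACA setICr setI0.
Qed.

(** The remainder [r n] is the value on [B] minus the first [n] pieces; these sets decrease to the
    empty set. *)
Lemma countably_additive_cvg B (F : nat -> set Om) : D B ->
  (forall i, measurable (F i)) -> trivIset setT F -> B `<=` \bigcup_n F n ->
  \sum_(i < n) nu (B `&` F i) @[n --> \oo] --> nu B.
Proof.
move=> DB mF tF BF.
pose r n := nu (B `\` \bigcup_(i < n) F i).
have mU n : measurable (\bigcup_(i < n) F i) by exact: bigcup_measurable.
have nuB n : nu B = \sum_(i < n) nu (B `&` F i) + r n.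
  elim: n => [|n IH]; first by rewrite big_ord0 add0r /r bigcup_mkord big_ord0 setD0.
  rewrite IH big_ord_recr/= -addrA; congr (_ + _).
  have mB := Dm _ DB.
  rewrite {1}/r (countably_additive_split _ (F n))//; last exact: covering_ringD.
  congr (nu _ + nu _).
    apply/seteqP; split=> [x [[Bx _] Fx]//|x [Bx Fx]].
    split=> //; split=> // -[k /= kn Fk].
    have /trivIsetP/(_ k n I I) := tF; rewrite ltn_eqF// => /(_ isT).
    by move=> FkFn; have : (F k `&` F n) x by []; rewrite FkFn.
  apply/seteqP; split=> [x [[Bx nx] Fx]|x [Bx nx]].
    split=> // -[k /=]; rewrite ltnS leq_eqVlt => /predU1P[->//|kn Fk].
    by apply: nx; exists k.
  split; last by move=> Fx; apply: nx; exists n => /=.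
  by split=> // -[k /= kn Fk]; apply: nx; exists k => //=; exact: ltnW.
have r0 : r n @[n --> \oo] --> 0.
  apply: snu.2 => [n|n x [Bx nx]|]; first exact: covering_ringD.
    by split=> // -[k /= kn Fk]; apply: nx; exists k => //=; exact: ltnW.
  apply/seteqP; split=> // x Bx; have [/BF[k _ Fk] _] := Bx 0%N I.
  by have [_] := Bx k.+1 I; apply; exists k => /=.
rewrite [X in X @ _](_ : _ = fun n => nu B - r n); last first.
  by apply/funext => n; rewrite (nuB n) addrK.
by rewrite -[X in _ --> X]subr0; apply: cvgB => //; exact: cvg_cst.
Qed.

Lemma pvar_ub A B : D B -> B `<=` A -> ((nu B)%:E <= pvar D nu A)%E.
Proof. by move=> DB BA; apply: ereal_sup_ubound; exists B. Qed.

Lemma pvar_ge0 A : (0 <= pvar D nu A)%E.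
Proof. by have := pvar_ub A set0 D0 (sub0set _); rewrite countably_additive0. Qed.

Lemma pvarD_le A B C : A `&` B = set0 -> A `<=` C -> B `<=` C ->
  (pvar D nu A + pvar D nu B <= pvar D nu C)%E.
Proof.
move=> AB AC BC; apply: ereal_supD_le.
- by exists set0; split.
- by exists set0; split.
move=> S T [DS SA] [DT TB]; rewrite -snu.1//; last exact: subsetI_eq0 AB.
apply: pvar_ub; first exact: DU.
by move=> x [/SA/AC|/TB/BC].
Qed.

Lemma pvar_sum_le n (F : 'I_n -> set Om) A :
  (forall i j, i != j -> F i `&` F j = set0) -> (forall i, F i `<=` A) ->
  (\sum_(i < n) pvar D nu (F i) <= pvar D nu A)%E.
Proof.
elim: n F A => [|n IH] F A F0 FA; first by rewrite big_ord0 pvar_ge0.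
rewrite big_ord_recr/=.
apply: (@le_trans _ _ (pvar D nu (A `\` F ord_max) + pvar D nu (F ord_max))%E).
  rewrite leeD2r//; apply: IH => [i j ij|i x Fx].
    by apply: F0; apply: contra ij => /eqP/(congr1 val) /= ij; apply/eqP/val_inj.
  split; first exact: FA Fx.
  move=> Fm; have : (F (widen_ord (leqnSn n) i) `&` F ord_max) x by [].
  rewrite F0// -val_eqE/= ltn_eqF//.
by apply: pvarD_le => //; rewrite setDE -setIA setICl setI0.
Qed.

(** One inequality is finite superadditivity. For the other, each competitor [B] in the union is cut
    into the pieces [B] meets [F i], and [nu B] is the limit of the corresponding partial sums. *)
Lemma pvar_semi_sigma_additive : semi_sigma_additive (pvar D nu).
Proof.
move=> F mF tF mUF.
have -> : pvar D nu (\bigcup_n F n) = (\sum_(i <oo) pvar D nu (F i))%E; last first.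
  by apply: is_cvg_ereal_nneg_natsum => n _; exact: pvar_ge0.
apply/eqP; rewrite eq_le; apply/andP; split; last first.
  apply: lime_le; first by apply: is_cvg_ereal_nneg_natsum => n _; exact: pvar_ge0.
  near=> n; rewrite big_mkord; apply: pvar_sum_le => [i j ij|i].
    by move/trivIsetP : tF; apply.
  exact: bigcup_sup.
apply: ge_ereal_sup => _ [B [DB BF] <-].
set s := (\sum_(i <oo) _)%E.
have hs n : ((\sum_(i < n) nu (B `&` F i))%:E <= s)%E.
  rewrite -sumEFin.
  apply: (@le_trans _ _ (\sum_(i < n) pvar D nu (F i))%E).
    apply: lee_sum => i _; apply: pvar_ub; last exact: subIsetr.
    exact: covering_ringI.
  have := @nneseries_lim_ge R (fun i => pvar D nu (F i)) xpredT 0 n.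
  by rewrite big_mkord; apply => i _ _; exact: pvar_ge0.
have cvB : (\sum_(i < n) nu (B `&` F i))%:E @[n --> \oo] --> (nu B)%:E.
  apply/cvg_EFin; first by near=> n.
  exact: countably_additive_cvg.
apply: (cvge_to_le cvB); exact: nearW.
Unshelve. all: by end_near.
Qed.

End Signed.
End CoveringRing.

End Variation.

(** Packaging [pvar] as a measure behind an equation lets integrals against the bare set function be
    rewritten into integrals against a measure. *)
Lemma pvar_measure {d : measure_display} {Om : measurableType d} {R : realType}
  (D : set (set Om)) (nu : set Om -> R) :
  covering_ring D -> countably_additive D nu ->
  exists P : {measure set Om -> \bar R}, pvar D nu = P :> (set Om -> \bar R).
Proof.
move=> cD snu.
have p0 : pvar D nu set0 = 0%E.
  apply/eqP; rewrite eq_le pvar_ge0// andbT; apply: ge_ereal_sup => _ [B [_ B0] <-].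
  have -> : B = set0 by apply/seteqP; split.
  by rewrite (countably_additive0 _ cD).
pose mx := isMeasure.Build d Om R (pvar D nu) p0 (pvar_ge0 _ cD _ snu)
  (pvar_semi_sigma_additive _ cD _ snu).
pose P : {measure set Om -> \bar R} := HB.pack (pvar D nu) mx.
by exists P.
Qed.

(** * Total variation and Hahn decomposition on a covering ring *)

Section VariationMeasure.
Context {d : measure_display} {Om : measurableType d} {R : realType}.
Variables (D : set (set Om)) (nu : set Om -> R).
Hypotheses (cD : covering_ring D) (snu : countably_additive D nu).
Implicit Types A B : set Om.

Let Dm A : D A -> measurable A. Proof. by case: cD => [h _ _ _]; exact: h. Qed.
Let snuN := countably_additiveN _ _ snu.

(** Each absolute value is [nu] or [- nu] of its set. Conversely, for competitors [S] and [T] the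
    intersection cancels in [nu S - nu T], leaving the two disjoint sets [S] minus [T] and [T] minus
    [S]. *)
Lemma var_pvar A : var D nu A = (pvar D nu A + pvar D (fun B => (- nu B)%R) A)%E.
Proof.
apply/eqP; rewrite eq_le; apply/andP; split.
  apply: ge_ereal_sup => _ [n [B [DB B0 ->]]].
  rewrite -sumEFin.
  apply: (@le_trans _ _ (\sum_(i < n) (pvar D nu (B i) + pvar D (fun C => (- nu C)%R) (B i)))%E).
    apply: lee_sum => i _; have [DBi _] := DB i.
    case: (ger0P (nu (B i))) => _.
      apply: (le_trans (pvar_ub D nu (B i) (B i) DBi _)) => //.
      by rewrite leeDl// (pvar_ge0 _ cD _ snuN).
    apply: (le_trans (pvar_ub D (fun C => - nu C) (B i) (B i) DBi _)) => //.
    by rewrite leeDr// (pvar_ge0 _ cD _ snu).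
  rewrite big_split/=; apply: leeD.
    by apply: (pvar_sum_le _ cD _ snu) => // i; exact: (DB i).2.
  by apply: (pvar_sum_le _ cD _ snuN) => // i; exact: (DB i).2.
have D0 := covering_ring0 _ cD.
apply: ereal_supD_le.
- by exists set0; split.
- by exists set0; split.
move=> S T [DS SA] [DT TA].
have [mS mT] := (Dm _ DS, Dm _ DT).
pose B (i : 'I_2) := if i == ord0 then S `\` T else T `\` S.
apply: (@le_trans _ _ (\sum_(i < 2) `|nu (B i)|)%:E).
  rewrite big_ord_recl big_ord_recl big_ord0 addr0 /B/= lee_fin.
  rewrite (countably_additive_split _ cD _ snu _ _ DS mT).
  rewrite (countably_additive_split _ cD _ snu _ _ DT mS) (setIC T).
  have := ler_norm (nu (S `\` T)); have := ler_norm (- nu (T `\` S)).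
  rewrite normrN; lra.
have DB i : D (B i) /\ B i `<=` A.
  by rewrite /B; case: ifP => _; (split; first exact: covering_ringD) => x [? _];
    [exact: SA | exact: TA].
apply: ereal_sup_ubound; exists 2%N, B; split=> //.
have ST0 : (S `\` T) `&` (T `\` S) = set0.
  by apply/seteqP; split=> // x [[? ?] [? ?]].
move=> [[|[|//]] i2] [[|[|//]] j2] // _; rewrite /B -!val_eqE/= ?ST0//.
by rewrite setIC ST0.
Qed.

(** [nu] is only given on [D], but its restriction [k] to the subsets of a fixed member [A] is a
    finite charge on the whole sigma-algebra, to which the Hahn decomposition applies. *)
Lemma hahn_on A : D A -> exists2 B, measurable B &
  pvar D (fun C => (- nu C)%R) (A `&` B) = 0%E /\ pvar D nu (A `\` B) = 0%E.
Proof.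
move=> DA; have mA := Dm _ DA.
pose k C : \bar R := (nu (C `&` A))%:E.
have DI C : measurable C -> D (C `&` A) by move=> mC; rewrite setIC; exact: covering_ringI.
have k0 : k set0 = 0%E by rewrite /k set0I (countably_additive0 _ cD _ snu).
have kf C : measurable C -> k C \is a fin_num by [].
have ks : semi_sigma_additive k.
  move=> F mF tF mUF.
  rewrite [X in X @ _](_ : _ = fun n =>
      (\sum_(i < n) nu ((\bigcup_n F n `&` A) `&` F i))%:E); last first.
    apply/funext => n; rewrite big_mkord -sumEFin; apply: eq_bigr => i _.
    congr (nu _)%:E; apply/seteqP; split=> [x [Fx Ax]|x [[_ Ax] Fx]] //.
    by split=> //; split=> //; exists i.
  apply/cvg_EFin; first by near=> n.
  apply: (countably_additive_cvg _ cD _ snu) => //; exact: DI.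
pose K : {charge set Om -> \bar R} := HB.pack k (isCharge.Build d Om R k k0 kf ks).
have [B [N [[mB Bpos] [mN Nneg] BN BN0]]] := Hahn_decomposition K.
exists B => //; split; apply/eqP; rewrite eq_le.
  rewrite (pvar_ge0 _ cD _ snuN) andbT.
  apply: ge_ereal_sup => _ [C [DC CAB] <-]; rewrite lee_fin oppr_le0.
  have := Bpos C (Dm _ DC) (subset_trans CAB (@subIsetr _ _ _)).
  by rewrite lee_fin (setIidl (subset_trans CAB (@subIsetl _ _ _))).
rewrite (pvar_ge0 _ cD _ snu) andbT.
apply: ge_ereal_sup => _ [C [DC CAB] <-].
have CN : C `<=` N.
  by move=> x /CAB[Ax nB]; have : setT x by []; rewrite -BN => -[].
have := Nneg C (Dm _ DC) CN.
by rewrite lee_fin (setIidl (subset_trans CAB (@subDsetl _ _ _))).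
Unshelve. all: by end_near.
Qed.

(** The local Hahn sets are cut down to [K n] and united. The complement of the union is covered by
    the sets [K n] minus [B n], so both null conditions are countable unions of local ones and the
    local sets may disagree. *)
Lemma hahn : exists2 B, measurable B &
  pvar D (fun C => (- nu C)%R) B = 0%E /\ pvar D nu (~` B) = 0%E.
Proof.
have [_ _ _ [K [DK _ KT]]] := cD.
have /choice[B hB] : forall n, exists B, measurable B /\
    (pvar D (fun C => (- nu C)%R) (K n `&` B) = 0%E /\ pvar D nu (K n `\` B) = 0%E).
  by move=> n; have [B mB h] := hahn_on _ (DK n); exists B.
have mK n : measurable (K n) := Dm _ (DK n).
have mB : measurable (\bigcup_n (K n `&` B n)).
  by apply: bigcup_measurable => n _; apply: measurableI => //; exact: (hB n).1.
exists (\bigcup_n (K n `&` B n)) => //.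
have null (mu : {measure set Om -> \bar R}) (F : nat -> set Om) A :
    (forall n, measurable (F n)) -> (forall n, mu (F n) = 0%E) -> measurable A ->
    A `<=` \bigcup_n F n -> mu A = 0%E.
  move=> mF F0 mA AF; apply/negligibleP => //; apply: negligibleS AF _.
  by apply: negligible_bigcup => n; apply/negligibleP; [exact: mF|exact: F0].
have [P PE] := pvar_measure _ _ cD snu; split; last first.
  rewrite PE; apply: (null _ (fun n => K n `\` B n)).
  - by move=> n; apply: measurableD => //; exact: (hB n).1.
  - by move=> n; rewrite -PE; exact: (hB n).2.2.
  - exact: measurableC.
  - move=> x nx; have : setT x by []; rewrite -KT => -[n _ Kx]; exists n => //.
    by split=> // Bx; apply: nx; exists n.
have [N NE] := pvar_measure _ _ cD snuN.
rewrite NE; apply: (null _ (fun n => K n `&` B n)) => // n.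
  by apply: measurableI => //; exact: (hB n).1.
by rewrite -NE; exact: (hB n).2.1.
Qed.

(** [nu] is nonpositive off [B] and nonnegative inside it: for a competitor [C], dropping the part
    off [B] and adding the rest of [A] inside [B] can only increase the value. *)
Lemma pvar_hahn A B : D A -> measurable B ->
  pvar D (fun C => (- nu C)%R) B = 0%E -> pvar D nu (~` B) = 0%E ->
  pvar D nu A = (nu (A `&` B))%:E.
Proof.
move=> DA mB NB PB; have mA := Dm _ DA.
have DAB : D (A `&` B) by exact: covering_ringI.
apply/eqP; rewrite eq_le (pvar_ub D nu A _ DAB (@subIsetl _ _ _)) andbT.
apply: ge_ereal_sup => _ [C [DC CA] <-]; have mC := Dm _ DC.
have c1 : nu (C `\` B) <= 0.
  by have := pvar_ub D nu (~` B) _ (covering_ringD _ cD _ _ DC mB) (@subDsetr _ _ _);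
    rewrite PB lee_fin.
have c2 : - nu ((A `&` B) `\` C) <= 0.
  have := pvar_ub D (fun C => - nu C) B _ (covering_ringD _ cD _ _ DAB mC).
  by rewrite NB lee_fin; apply=> x [[]].
rewrite (countably_additive_split _ cD _ snu _ _ DC mB).
rewrite (countably_additive_split _ cD _ snu _ _ DAB mC) lee_fin.
have -> : A `&` B `&` C = C `&` B.
  by apply/seteqP; split=> [x [[? ?] ?]//|x [Cx ?]]; split=> //; split=> //; exact: CA.
lra.
Qed.

End VariationMeasure.

(** * Order continuous functionals as integrals *)

Section OrderContinuous.
Context {d : measure_display} {Om : measurableType d} {R : realType}.

Definition ideal_space (V : set (Om -> R)) : Prop :=
  [/\ (forall f, V f -> measurable_fun setT f),
      (forall a f g, V f -> V g -> V (fun x => a * f x + g x)) &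
      (forall f (g : Om -> R), V f -> measurable_fun setT g ->
        (forall x, `|g x| <= `|f x|) -> V g)].

(** [L] stands for a functional of the dual ball composed with the operator, and [nu] for its values
    on indicators. Order continuity is tested only on sequences decreasing to 0 at every point, so
    that no null sets occur. *)
Definition represents (V : set (Om -> R)) (L : (Om -> R) -> R) (D : set (set Om))
    (nu : set Om -> R) : Prop :=
  [/\ ideal_space V,
      (forall a f g, V f -> V g -> L (fun x => a * f x + g x) = a * L f + L g),
      (forall u : nat -> Om -> R, (forall n, V (u n)) ->
        (forall n x, u n.+1 x <= u n x) ->
        (forall x, u n x @[n --> \oo] --> 0) -> L (u n) @[n --> \oo] --> 0),
      covering_ring D &
      forall A, D A -> V \1_A /\ nu A = L \1_A].

Lemma representsN V L D nu : represents V L D nu ->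
  represents V (fun f => - L f) D (fun A => - nu A).
Proof.
move=> [iV Llin Loc cD DV]; split=> //.
- by move=> a f g Vf Vg; rewrite Llin// opprD mulrN.
- by move=> u Vu uS u0; rewrite -oppr0; apply: cvgN; exact: Loc.
- by move=> A DA; have [? ->] := DV _ DA.
Qed.

Section Functional.
Variables (V : set (Om -> R)) (L : (Om -> R) -> R).
Variables (D : set (set Om)) (nu : set Om -> R).
Hypothesis rep : represents V L D nu.

Let iV : ideal_space V. Proof. by case: rep. Qed.
Let Llin a f g : V f -> V g -> L (fun x => a * f x + g x) = a * L f + L g.
Proof. by case: rep => [_ h _ _ _]; exact: h. Qed.
Let Loc (u : nat -> Om -> R) : (forall n, V (u n)) -> (forall n x, u n.+1 x <= u n x) ->
  (forall x, u n x @[n --> \oo] --> 0) -> L (u n) @[n --> \oo] --> 0.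
Proof. by case: rep => [_ _ h _ _]; exact: h. Qed.
Let cD : covering_ring D. Proof. by case: rep. Qed.
Let DV A : D A -> V \1_A. Proof. by case: rep => [_ _ _ _ h] /h[]. Qed.
Let nuE A : D A -> nu A = L \1_A. Proof. by case: rep => [_ _ _ _ h] /h[]. Qed.
Let Vm f : V f -> measurable_fun setT f. Proof. by case: iV => [h _ _]; exact: h. Qed.
Let Vlin a f g : V f -> V g -> V (fun x => a * f x + g x).
Proof. by case: iV => [_ h _]; exact: h. Qed.
Let Vid f (g : Om -> R) : V f -> measurable_fun setT g -> (forall x, `|g x| <= `|f x|) -> V g.
Proof. by case: iV => [_ _ h]; exact: h. Qed.
Let Dm A : D A -> measurable A. Proof. by case: cD => [h _ _ _]; exact: h. Qed.

Let indic01 A (x : Om) : (0 <= \1_A x :> R) && (\1_A x <= 1 :> R).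
Proof. by rewrite indicE; case: (_ \in _); rewrite ?lexx ?ler01. Qed.

Lemma ideal_space_indic f A : V f -> measurable A -> V (fun x => f x * \1_A x).
Proof.
move=> Vf mA; apply: (Vid f) => //.
  by apply: measurable_funM; [exact: Vm | exact: measurable_indic].
move=> x; rewrite normrM ler_piMr//.
by have /andP[? ?] := indic01 A x; rewrite ger0_norm.
Qed.

Lemma functional0 : V (fun=> 0) /\ L (fun=> 0) = 0.
Proof.
have V0 : V (fun=> 0).
  have /DV V1 := covering_ring0 _ cD.
  by apply: (Vid _ _ V1) => // x; rewrite normr0.
split=> //; have := Llin 1 _ _ V0 V0.
rewrite (_ : (fun=> _) = fun=> 0); first lra.
by apply/funext => x; rewrite mulr0 addr0.
Qed.

Lemma functionalD f g : V f -> V g -> L (fun x => f x + g x) = L f + L g.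
Proof.
move=> Vf Vg; have := Llin 1 _ _ Vf Vg; rewrite mul1r => <-.
by congr L; apply/funext => x; rewrite mul1r.
Qed.

(** Indicators of sets decreasing to the empty set decrease to 0 at every point, each point leaving
    the sets eventually. *)
Lemma functional_countably_additive : countably_additive D nu.
Proof.
split=> [A B DA DB AB|F DF FS F0].
  have [_ _ DU _] := cD.
  rewrite !nuE//; last exact: DU.
  rewrite -functionalD//; [|exact: DV..].
  congr L; apply/funext => x; rewrite !indicE in_setU.
  have [xA|xA] := boolP (x \in A); have [xB|xB] := boolP (x \in B); rewrite ?addr0 ?add0r//.
  have : (A `&` B) x by split; exact: set_mem.
  by rewrite AB.
rewrite (_ : (fun n => _) = fun n => L \1_(F n)); last by apply/funext => n; rewrite nuE.
apply: Loc => [n|n x|x]; first exact: DV.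
  rewrite !indicE; have [xF|xF] := boolP (x \in F n.+1); last by case: (_ \in _).
  by rewrite (_ : x \in F n = true)//; apply/mem_set/FS/set_mem.
have [k nFk] : exists k, ~ F k x.
  apply: contrapT => h; have : (\bigcap_n F n) x.
    by move=> k _; apply: contrapT => nF; apply: h; exists k.
  by rewrite F0.
have Fle n m : (n <= m)%N -> F m `<=` F n.
  by move=> nm; rewrite -(subnKC nm); elim: (m - n)%N => [|i IH]; rewrite ?addn0// addnS => y /FS /IH.
apply: cvg_near_cst; near=> n; rewrite indicE memNset// => Fx; apply: nFk.
by apply: (Fle k n) Fx; near: n; exact: nbhs_infty_ge.
Unshelve. all: by end_near.
Qed.

Lemma functional_sum (I : Type) (s : seq I) (c : I -> R) (f : I -> Om -> R) :
  (forall i, V (f i)) ->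
  V (fun x => \sum_(i <- s) c i * f i x) /\
  L (fun x => \sum_(i <- s) c i * f i x) = \sum_(i <- s) c i * L (f i).
Proof.
move=> Vf; elim: s => [|i s [IV IL]].
  rewrite big_nil (_ : (fun x => _) = fun=> 0); first exact: functional0.
  by apply/funext => x; rewrite big_nil.
rewrite big_cons (_ : (fun x => _) = fun x => c i * f i x + \sum_(i <- s) c i * f i x); last first.
  by apply/funext => x; rewrite big_cons.
by split; [exact: Vlin | rewrite Llin// IL].
Qed.

Section Positive.
Variable B : set Om.
Hypotheses (mB : measurable B) (NB : pvar D (fun C => (- nu C)%R) B = 0%E)
  (PB : pvar D nu (~` B) = 0%E).
Let snu := functional_countably_additive.

(** Intersecting the level sets of [h] with [A] puts them in [D], where [pvar_hahn] evaluates the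
    positive variation as [nu] on the part inside [B]. *)
Lemma integral_nnsfun_pvar (h : {nnsfun Om >-> R}) A : D A ->
  (\int[pvar D nu]_(x in A) (h x)%:E = (L (fun x => h x * \1_(A `&` B) x))%:E)%E.
Proof.
move=> DA; have mA := Dm _ DA.
have [P PE] := pvar_measure _ _ cD snu.
set s := finmap.enum_fset (fset_set (range h)).
have hE x : h x = \sum_(i < size s) s`_i * \1_(h @^-1` [set s`_i]) x by exact: fimfunEord.
have mh r : measurable (h @^-1` [set r]) by [].
rewrite [in RHS](_ : (fun x => _) =
    fun x => \sum_(i < size s) s`_i * \1_(h @^-1` [set s`_i] `&` A `&` B) x); last first.
  apply/funext => x; rewrite hE mulr_suml; apply: eq_bigr => i _.
  by rewrite -mulrA -setIA [in RHS]indicI.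
have DhA i : D (h @^-1` [set s`_i] `&` A) by rewrite setIC; exact: covering_ringI.
have [i|_ ->] := functional_sum _ (index_enum 'I_(size s)) (fun i => s`_i)
    (fun i => \1_(h @^-1` [set s`_i] `&` A `&` B)).
  by apply: DV; exact: covering_ringI.
rewrite PE; under eq_integral do rewrite hE -sumEFin.
rewrite ge0_integral_sum//; last 2 first.
- move=> i; apply/measurable_EFinP; apply: measurable_funM => //.
- by move=> i x _; rewrite EFinM; exact: nnfun_muleindic_ge0.
rewrite -sumEFin; apply: eq_bigr => i _.
rewrite integralZl_indic_nnsfun// integral_indic// EFinM; congr (_ * _)%E.
rewrite -PE (pvar_hahn _ _ cD snu _ B)// nuE//.
exact: covering_ringI.
Qed.

(** Simple functions increase to [f]: the integrals converge by monotone convergence, the values of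
    [L] by order continuity. The right side being a real number, integrability of [f] comes for
    free. *)
Lemma integral_pvar f : V f -> (forall x, 0 <= f x) ->
  (\int[pvar D nu]_x (f x)%:E = (L (fun x => f x * \1_B x))%:E)%E.
Proof.
move=> Vf f0; have [P PE] := pvar_measure _ _ cD snu.
have [_ _ _ [K [DK KS KT]]] := cD.
have mf := Vm _ Vf.
have mf' : measurable_fun setT (EFin \o f) by apply/measurable_EFinP.
have Kle n m : (n <= m)%N -> K n `<=` K m.
  by move=> nm; rewrite -(subnKC nm); elim: (m - n)%N => [|i IH]; rewrite ?addn0// addnS => y /IH /KS.
pose h := nnsfun_approx measurableT mf'.
have hcv x : h n x @[n --> \oo] --> f x.
  have f0' y : setT y -> (0 <= (EFin \o f) y)%E by rewrite lee_fin.
  by have /fine_cvgP[_] := cvg_nnsfun_approx measurableT mf' f0' (I : setT x).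
have hnd x : {homo (fun n => h n x) : n m / (n <= m)%N >-> n <= m}.
  by move=> n m nm; exact/lefP/nd_nnsfun_approx.
have hf n x : h n x <= f x.
  rewrite -(cvg_lim _ (hcv x))//; apply: nondecreasing_cvgn_le; first exact: hnd.
  by apply/cvg_ex; exists (f x).
(* The cutoff to [K n], a member of [D], makes [integral_nnsfun_pvar] applicable; since the [K n]
   exhaust the space, [g n] still increases to [f]. *)
pose g n x := h n x * \1_(K n) x.
have g0 n x : 0 <= g n x by rewrite mulr_ge0//; have /andP[] := indic01 (K n) x.
have gnd x : {homo (fun n => g n x) : n m / (n <= m)%N >-> n <= m}.
  move=> n m nm; apply: ler_pM => //; first exact: hnd.
  rewrite !indicE; have [xK|_] := boolP (x \in K n); last by case: (_ \in _).
  by rewrite (_ : x \in K m = true)//; apply/mem_set/(Kle n m nm)/set_mem.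
have gf n x : g n x <= f x.
  by apply: le_trans (hf n x); rewrite /g ler_piMr//; have /andP[] := indic01 (K n) x.
have gcv x : g n x @[n --> \oo] --> f x.
  apply: cvg_trans (hcv x); apply: near_eq_cvg.
  have : setT x by []; rewrite -KT => -[k _ Kkx].
  near=> n; rewrite /g indicE mem_set ?mulr1//.
  by apply: (Kle k) => //; near: n; exact: nbhs_infty_ge.
have mg n : measurable_fun setT (g n).
  by apply: measurable_funM => //; apply: measurable_indic; exact: Dm.
have Vg n : V (g n).
  apply: (Vid _ _ Vf) => // x.
  by rewrite !ger0_norm.
have gE n : (\int[P]_x (g n x)%:E = (L (fun x => g n x * \1_B x))%:E)%E.
  have := integral_nnsfun_pvar (h n) (K n) (DK n).
  rewrite PE integral_mkcond.
  rewrite (_ : ((fun x => (h n x)%:E) \_ (K n)) = EFin \o g n); last first.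
    by rewrite -[LHS]/((EFin \o h n) \_ (K n)) restrict_EFin patch_indic.
  move=> ->; congr (L _)%:E; apply/funext => x.
  by rewrite indicI/= mulrA.
have c1 : (\int[P]_x (g n x)%:E)%E @[n --> \oo] --> (\int[P]_x (f x)%:E)%E.
  have -> : (\int[P]_x (f x)%:E = \int[P]_x limn (fun n => (g n x)%:E))%E.
    apply: eq_integral => x _; apply/esym/cvg_lim => //.
    by apply/cvg_EFin; [exact: nearW | exact: gcv].
  apply: cvg_monotone_convergence => //.
  - by move=> n; apply/measurable_EFinP.
  - by move=> n x _; rewrite lee_fin.
  - by move=> x _ n m nm; rewrite lee_fin; exact: gnd.
have c2 : L (fun x => g n x * \1_B x) @[n --> \oo] --> L (fun x => f x * \1_B x).
  have VfB := ideal_space_indic _ _ Vf mB.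
  have VgB n := ideal_space_indic _ _ (Vg n) mB.
  (* The differences [f - g n], restricted to [B], decrease to 0, which is the situation covered by
     [Loc]. *)
  have Vu n : V (fun x => -1 * (g n x * \1_B x) + f x * \1_B x) by exact: Vlin.
  have : L (fun x => -1 * (g n x * \1_B x) + f x * \1_B x) @[n --> \oo] --> 0.
    apply: Loc => // [n x|x].
      have := gnd x n n.+1 (leqnSn n); have /andP[+ _] := indic01 B x; nra.
    rewrite -[0](_ : -1 * (f x * \1_B x) + f x * \1_B x = 0); last by ring.
    by apply: cvgD; [apply: cvgMr; apply: cvgMl; exact: gcv | exact: cvg_cst].
  move=> c; rewrite -[X in _ --> X](subr0); rewrite [X in X @ _](_ : _ = fun n =>
      L (fun x => f x * \1_B x) - L (fun x => -1 * (g n x * \1_B x) + f x * \1_B x)).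
    by apply: cvgB => //; exact: cvg_cst.
  by apply/funext => n; rewrite Llin//; ring.
rewrite PE; apply: (cvg_unique _ c1) => //.
have : (L (fun x => g n x * \1_B x))%:E @[n --> \oo] --> (L (fun x => f x * \1_B x))%:E.
  by apply/cvg_EFin; [exact: nearW | exact: c2].
by apply: cvg_trans; apply: near_eq_cvg; apply: nearW => n; rewrite gE.
Unshelve. all: by end_near.
Qed.

Lemma integral_pvar_real f : V f ->
  (\int[pvar D nu]_x (f x)%:E = (L (fun x => f x * \1_B x))%:E)%E.
Proof.
move=> Vf; have [P PE] := pvar_measure _ _ cD snu.
have Vp : V (fun x => Num.max (f x) 0).
  apply: (Vid _ _ Vf) => [|x]; first by apply: measurable_maxr => //; exact: Vm.
  by rewrite maxEle; case: ifP => //; rewrite normr0.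
have Vn : V (fun x => Num.max (- f x) 0).
  apply: (Vid _ _ Vf) => [|x].
    by apply: measurable_maxr => //; apply: measurable_funN; exact: Vm.
  by rewrite maxEle -[leRHS]normrN; case: ifP => //; rewrite normr0.
rewrite PE integralE.
have -> : (\int[P]_x ((fun y => (f y)%:E)^\+ x) = \int[P]_x (Num.max (f x) 0)%:E)%E.
  by apply: eq_integral => x _; rewrite funeposE EFin_max.
have -> : (\int[P]_x ((fun y => (f y)%:E)^\- x) = \int[P]_x (Num.max (- f x) 0)%:E)%E.
  by apply: eq_integral => x _; rewrite funenegE EFin_max EFinN.
rewrite -PE !integral_pvar// => [|x|x]; rewrite ?le_max ?lexx ?orbT//.
rewrite -EFinB; congr (_%:E).
have VpB := ideal_space_indic _ _ Vp mB; have VnB := ideal_space_indic _ _ Vn mB.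
have := Llin (-1) _ _ VnB VpB; rewrite mulN1r addrC => <-.
congr L; apply/funext => x; rewrite mulN1r -mulNr -mulrDl; congr (_ * _).
by rewrite !maxElt oppr_lt0; case: ltgtP => //; lra.
Qed.

End Positive.

End Functional.

Section FunctionalIntegral.
Variables (V : set (Om -> R)) (L : (Om -> R) -> R).
Variables (D : set (set Om)) (nu : set Om -> R).
Hypothesis rep : represents V L D nu.

Let iV : ideal_space V. Proof. by case: rep. Qed.
Let Vm f : V f -> measurable_fun setT f. Proof. by case: iV => [h _ _]; exact: h. Qed.
Let cD : covering_ring D. Proof. by case: rep. Qed.
Let snu := functional_countably_additive _ _ _ _ rep.

(** The second formula is the first one for [- L] and [- nu], whose Hahn set is the complement of
    [B]. *)
Lemma functional_integral : exists2 B, measurable B &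
  forall f, V f -> (\int[pvar D nu]_x (f x)%:E = (L (fun x => f x * \1_B x))%:E)%E /\
    (\int[pvar D (fun C => (- nu C)%R)]_x (f x)%:E =
     (- L (fun x => f x * \1_(~` B) x))%:E)%E.
Proof.
have [B mB [NB PB]] := hahn _ _ cD snu.
exists B => // f Vf; split; first exact: (integral_pvar_real _ _ _ _ rep).
apply: (integral_pvar_real _ _ _ _ (representsN _ _ _ _ rep)) => //.
- exact: measurableC.
- by under [fun C => _]eq_fun do rewrite opprK.
- by rewrite setCK.
Qed.

(** The parts of [f] times the indicator of [A] inside and outside the Hahn set add up again under
    [L]. *)
Lemma functional_sint f A : V f -> measurable A ->
  sint D nu A f = L (fun x => f x * \1_A x).
Proof.
move=> Vf mA; have [B mB hB] := functional_integral.
have VfA := ideal_space_indic _ _ _ _ rep _ _ Vf mA.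
have [P PE] := pvar_measure _ _ cD snu.
have [N NE] := pvar_measure _ _ cD (countably_additiveN _ _ snu).
have fAE : (fun x => (f x)%:E) \_ A = EFin \o (fun x => f x * \1_A x).
  by rewrite -[LHS]/((EFin \o f) \_ A) restrict_EFin patch_indic.
rewrite /sint PE NE integral_mkcond [in X in _ - X]integral_mkcond fAE -PE -NE.
have [-> ->] := hB _ VfA; rewrite /= opprK -(functionalD _ _ _ _ rep); last 2 first.
- exact: (ideal_space_indic _ _ _ _ rep).
- by apply: (ideal_space_indic _ _ _ _ rep) => //; exact: measurableC.
congr L; apply/funext => x; rewrite -mulrDr !indicE in_setC.
by case: (x \in B); rewrite /= ?addr0 ?add0r mulr1.
Qed.

Lemma functional_var_lty f : V f -> (\int[var D nu]_x (`|f x|)%:E < +oo)%E.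
Proof.
move=> Vf; have [B mB hB] := functional_integral.
have [P PE] := pvar_measure _ _ cD snu.
have [N NE] := pvar_measure _ _ cD (countably_additiveN _ _ snu).
have -> : var D nu = measure_add P N.
  by apply/funext => A; rewrite (var_pvar _ _ cD snu) measure_addE -PE -NE.
have Vn : V (fun x => `|f x|).
  case: iV => [_ _ Vid]; apply: (Vid _ _ Vf) => [|x]; last by rewrite normr_id.
  by apply: measurableT_comp => //; exact: Vm.
rewrite ge0_integral_measure_add//; last by apply/measurable_EFinP; exact: Vm.
by rewrite -PE -NE; have [-> ->] := hB _ Vn; rewrite -EFinD ltry.
Qed.

End FunctionalIntegral.
End OrderContinuous.

(** * Integration against a signed set function *)

Section SignedIntegral.
Context {d : measure_display} {Om : measurableType d} {R : realType}.
Variables (D : set (set Om)) (nu : set Om -> R).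
Hypotheses (cD : covering_ring D) (snu : countably_additive D nu).

Definition absint (f : Om -> R) : \bar R := (\int[var D nu]_x (`|f x|)%:E)%E.

Definition signed_integrable (f : Om -> R) : Prop :=
  measurable_fun setT f /\ (absint f < +oo)%E.

(** Reduces statements on [absint] and [sint] to statements on two measures and their sum. *)
Lemma var_measure_add : exists P N : {measure set Om -> \bar R},
  [/\ pvar D nu = P, pvar D (fun A => - nu A) = N & var D nu = measure_add P N].
Proof.
have [P PE] := pvar_measure _ _ cD snu.
have [N NE] := pvar_measure _ _ cD (countably_additiveN _ _ snu).
exists P, N; split=> //.
by apply/funext => A; rewrite (var_pvar _ _ cD snu) measure_addE -PE -NE.
Qed.

Lemma absint_ge0 f : (0 <= absint f)%E.
Proof.
have [P [N [_ _ VE]]] := var_measure_add.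
by rewrite /absint VE; apply: integral_ge0 => x _; rewrite lee_fin.
Qed.

Lemma le_absint (f g : Om -> R) : measurable_fun setT f -> measurable_fun setT g ->
  (forall x, `|f x| <= `|g x|) -> (absint f <= absint g)%E.
Proof.
move=> mf mg fg; have [P [N [_ _ VE]]] := var_measure_add.
rewrite /absint VE; apply: ge0_le_integral => //.
- by apply/measurable_EFinP; exact: measurableT_comp.
- by apply/measurable_EFinP; exact: measurableT_comp.
- by move=> x _; rewrite lee_fin.
Qed.

Lemma absintZ (a : R) (f : Om -> R) : 0 <= a -> measurable_fun setT f ->
  absint (fun x => a * f x) = (a%:E * absint f)%E.
Proof.
move=> a0 mf; have [P [N [_ _ VE]]] := var_measure_add.
rewrite /absint VE -ge0_integralZl_EFin//.
- by apply: eq_integral => x _; rewrite normrM ger0_norm// EFinM.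
- by apply/measurable_EFinP; exact: measurableT_comp.
Qed.

Lemma signed_integrableP (P N : {measure set Om -> \bar R}) f :
  var D nu = measure_add P N -> signed_integrable f <->
  P.-integrable setT (EFin \o f) /\ N.-integrable setT (EFin \o f).
Proof.
move=> VE; rewrite /signed_integrable /absint VE.
have E : measurable_fun setT f -> (\int[measure_add P N]_x (`|f x|)%:E =
   \int[P]_x (`|f x|)%:E + \int[N]_x (`|f x|)%:E)%E.
  move=> mf; rewrite ge0_integral_measure_add//.
  by apply/measurable_EFinP; exact: measurableT_comp.
split=> [[mf]|[/integrableP[/measurable_EFinP mf Pf] /integrableP[_ Nf]]]; last first.
  by split=> //; rewrite E// lte_add_pinfty.
rewrite E// => fin.
have mf' : measurable_fun setT (EFin \o f) by apply/measurable_EFinP.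
split; apply/integrableP; split=> //; apply: le_lt_trans fin.
  by rewrite leeDl// integral_ge0.
by rewrite leeDr// integral_ge0.
Qed.

Lemma le_signed_integrable (f g : Om -> R) : signed_integrable g -> measurable_fun setT f ->
  (forall x, `|f x| <= `|g x|) -> signed_integrable f.
Proof.
by move=> [mg g1] mf fg; split=> //; apply: le_lt_trans g1; exact: le_absint.
Qed.

Lemma signed_integrable_lin a f g : signed_integrable f -> signed_integrable g ->
  signed_integrable (fun x => a * f x + g x).
Proof.
have [P [N [PE NE VE]]] := var_measure_add.
move=> /(signed_integrableP _ _ _ VE)[Pf Nf] /(signed_integrableP _ _ _ VE)[Pg Ng].
apply/(signed_integrableP _ _ _ VE).
have lin (mu : {measure set Om -> \bar R}) : mu.-integrable setT (EFin \o f) ->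
    mu.-integrable setT (EFin \o g) -> mu.-integrable setT (EFin \o (fun x => a * f x + g x)).
  by move=> mf mg; apply: (integrableD measurableT (integrableZl measurableT a mf) mg).
by split; exact: lin.
Qed.

Lemma sint_lin A a f g : measurable A -> signed_integrable f -> signed_integrable g ->
  sint D nu A (fun x => a * f x + g x) = a * sint D nu A f + sint D nu A g.
Proof.
move=> mA; have [P [N [PE NE VE]]] := var_measure_add.
move=> /(signed_integrableP _ _ _ VE)[Pf Nf] /(signed_integrableP _ _ _ VE)[Pg Ng].
have lin (mu : {measure set Om -> \bar R}) : mu.-integrable setT (EFin \o f) ->
    mu.-integrable setT (EFin \o g) ->
    \int[mu]_(x in A) (a * f x + g x) = a * \int[mu]_(x in A) f x + \int[mu]_(x in A) g x.
  move=> mf mg.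
  have Af := integrableS measurableT mA (@subsetT _ A) mf.
  have Ag := integrableS measurableT mA (@subsetT _ A) mg.
  by rewrite RintegralD// ?RintegralZl//; exact: (integrableZl mA a Af).
rewrite /sint PE NE.
rewrite -[fine _ - _]/(\int[P]_(x in A) (a * f x + g x) - \int[N]_(x in A) (a * f x + g x)).
rewrite !lin// /Rintegral; ring.
Qed.

Lemma norm_sint_le A f : measurable A -> signed_integrable f ->
  `|sint D nu A f| <= fine (absint f).
Proof.
move=> mA sf; have [P [N [PE NE VE]]] := var_measure_add.
have [Pf Nf] := (signed_integrableP _ _ _ VE).1 sf.
have mf' : measurable_fun setT (fun x => (`|f x|)%:E).
  by apply/measurable_EFinP; apply: measurableT_comp => //; exact: sf.1.
have le1 (mu : {measure set Om -> \bar R}) : mu.-integrable setT (EFin \o f) ->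
    `|\int[mu]_(x in A) f x| <= \int[mu]_x `|f x|.
  move=> mf.
  have Af := integrableS measurableT mA (@subsetT _ A) mf.
  apply: (le_trans (le_normr_Rintegral mA Af)).
  have fin1 B : measurable B -> (\int[mu]_(x in B) (`|f x|)%:E)%E \is a fin_num.
    move=> mB; apply: integrable_fin_num => //.
    exact: (integrable_norm (integrableS measurableT mB (@subsetT _ B) mf)).
  apply: fine_le; [exact: fin1|exact: fin1|].
  by apply: ge0_subset_integral.
rewrite /sint PE NE; apply: (le_trans (ler_normB _ _)).
rewrite /absint VE ge0_integral_measure_add// [in leRHS]fineD; last 2 first.
- by apply: integrable_fin_num => //; exact: (integrable_norm Pf).
- by apply: integrable_fin_num => //; exact: (integrable_norm Nf).
by apply: lerD; exact: le1.
Qed.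

Lemma sint_indic A B f : sint D nu A (fun x => f x * \1_B x) = sint D nu (A `&` B) f.
Proof.
have [P [N [PE NE VE]]] := var_measure_add.
have E (mu : {measure set Om -> \bar R}) :
    (\int[mu]_(x in A) (f x * \1_B x)%:E = \int[mu]_(x in A `&` B) (f x)%:E)%E.
  rewrite integral_mkcond [RHS]integral_mkcond; apply: eq_integral => x _.
  rewrite !patchE in_setI indicE.
  by case: (x \in A) => //=; case: (x \in B); rewrite ?mulr1 ?mulr0.
by rewrite /sint PE NE !E.
Qed.

Lemma absint_ae (f g : Om -> R) Z : measurable_fun setT f -> measurable_fun setT g ->
  measurable Z -> var D nu Z = 0%E -> (forall x, ~ Z x -> f x = g x) ->
  absint f = absint g /\ forall A, measurable A -> sint D nu A f = sint D nu A g.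
Proof.
move=> mf mg mZ Z0 fg; have [P [N [PE NE VE]]] := var_measure_add.
have PZ : P Z = 0%E.
  apply/eqP; rewrite -measure_le0 -Z0 VE measure_addE leeDl//.
have NZ : N Z = 0%E.
  apply/eqP; rewrite -measure_le0 -Z0 VE measure_addE leeDr//.
have aeE (mu : {measure set Om -> \bar R}) A (f' g' : Om -> R) : measurable A -> mu Z = 0%E ->
    measurable_fun setT f' -> measurable_fun setT g' -> (forall x, ~ Z x -> f' x = g' x) ->
    (\int[mu]_(x in A) (f' x)%:E = \int[mu]_(x in A) (g' x)%:E)%E.
  move=> mA muZ mf' mg' fg'; apply: ae_eq_integral => //.
  - by apply/measurable_EFinP; exact: measurable_funTS.
  - by apply/measurable_EFinP; exact: measurable_funTS.
  - exists Z; split=> // x /= h; apply: contrapT => nZ; apply: h => _.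
    by rewrite fg'.
split=> [|A mA]; last by rewrite /sint PE NE !(aeE _ A f g).
have mn (h : Om -> R) : measurable_fun setT h -> measurable_fun setT (fun x => `|h x|).
  by move=> mh; exact: measurableT_comp.
have VZ : measure_add P N Z = 0%E by rewrite -VE.
have := aeE (measure_add P N) setT (fun x => `|f x|) (fun x => `|g x|) measurableT VZ (mn _ mf) (mn _ mg).
by rewrite /absint VE; apply => x /fg ->.
Qed.

(** Recovers the integral against the total variation from the indefinite integral. On [A] the sign
    of [f] agrees with the Hahn decomposition, so changing the sign of [f] off [A] gives the
    absolute value of [f] on [B] and its negative off [B]. *)
Lemma absint_sint f : signed_integrable f -> exists2 A, measurable A &
  fine (absint f) = 2 * sint D nu A f - sint D nu setT f.
Proof.
move=> sf; have [P [N [PE NE VE]]] := var_measure_add.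
have [B mB [NB PB]] := hahn _ _ cD snu.
have [mf _] := sf.
have [Pf Nf] := (signed_integrableP _ _ _ VE).1 sf.
pose G := [set x | 0 <= f x].
have mG : measurable G.
  rewrite (_ : G = f @^-1` `[0, +oo[); last by apply/seteqP; split=> x /=; rewrite in_itv/= andbT.
  by rewrite -[X in measurable X]setTI; exact: mf.
pose A := (B `&` G) `|` (~` B `&` ~` G).
have mA : measurable A.
  by apply: measurableU; apply: measurableI => //; exact: measurableC.
exists A => //.
pose h x := 2 * (f x * \1_A x) + -1 * f x.
have hB x : B x -> h x = `|f x|.
  move=> Bx; rewrite /h indicE; have [Gx|nG] := pselect (G x).
    rewrite mem_set; last by left.
    by rewrite ger0_norm//=; ring.
  rewrite memNset; last by case=> -[].
  by rewrite ltr0_norm /=; [ring | rewrite ltNge; apply/negP].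
have hNB x : ~ B x -> h x = - `|f x|.
  move=> nB; rewrite /h indicE; have [Gx|nG] := pselect (G x).
    rewrite memNset; last by case=> -[].
    by rewrite ger0_norm//=; ring.
  rewrite mem_set; last by right.
  by rewrite ltr0_norm /=; [ring | rewrite ltNge; apply/negP].
have sfA : signed_integrable (fun x => f x * \1_A x).
  apply: (le_signed_integrable _ _ sf) => [|x].
    by apply: measurable_funM => //; exact: measurable_indic.
  by rewrite normrM indicE; case: (_ \in _); rewrite ?normr1 ?normr0 ?mulr1 ?mulr0.
have -> : 2 * sint D nu A f - sint D nu setT f = sint D nu setT h.
  have sNf : signed_integrable (fun x => -1 * f x).
    apply: (le_signed_integrable _ _ sf) => [|x]; first exact: measurable_funM.
    by rewrite mulN1r normrN.
  rewrite /h sint_lin// sint_indic setTI.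
  have := sint_lin setT (-1) f f measurableT sf sf.
  have := sint_lin setT (-2) f f measurableT sf sf.
  rewrite [X in sint _ _ _ X](_ : _ = fun x => -1 * f x); last first.
    by apply/funext => x; ring.
  by move=> -> _; ring.
have mh : measurable_fun setT (EFin \o h).
  apply/measurable_EFinP; apply: measurable_funD; apply: measurable_funM => //.
  by apply: measurable_funM => //; exact: measurable_indic.
have mnf : measurable_fun setT (fun x => (`|f x|)%:E).
  by apply/measurable_EFinP; exact: measurableT_comp.
rewrite /sint PE NE.
have -> : (\int[P]_x (h x)%:E = \int[P]_x (`|f x|)%:E)%E.
  apply: ae_eq_integral => //; exists (~` B); split; [exact: measurableC|by rewrite -PE|].
  by move=> x /= nh; apply: contrapT => /contrapT Bx; apply: nh => _; rewrite hB.
have -> : (\int[N]_x (h x)%:E = \int[N]_x (- (`|f x|)%:E))%E.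
  apply: ae_eq_integral => //; first exact: measurableT_comp.
  exists B; split=> //; first by rewrite -NE.
  by move=> x /= nh; apply: contrapT => nB; apply: nh => _; rewrite hNB.
rewrite integral_ge0N//.
rewrite fineN opprK /absint VE ge0_integral_measure_add// [in LHS]fineD//.
- by apply: integrable_fin_num => //; exact: (integrable_norm Pf).
- by apply: integrable_fin_num => //; exact: (integrable_norm Nf).
Qed.

End SignedIntegral.

(** * The space L^1 of a vector measure *)

Section DualBall.
Context {R : realType} {E : normedModType R}.

Lemma dualB0 (xs : E -> R) : dualB xs -> xs 0 = 0.
Proof. by move=> [h _]; have := h 1 0 0; rewrite scaler0 addr0 mul1r; lra. Qed.

Lemma dualBB (xs : E -> R) u v : dualB xs -> xs (u - v) = xs u - xs v.
Proof. by move=> [h _]; rewrite -scaleN1r addrC h; ring. Qed.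

Lemma dualB_cvg (xs : E -> R) (u : nat -> E) (l : E) : dualB xs ->
  u n @[n --> \oo] --> l -> xs (u n) @[n --> \oo] --> xs l.
Proof.
move=> xsB ul; apply/cvgrPdist_le => e e0.
move/cvgrPdist_le : ul => /(_ e e0); apply: filterS => n.
by apply: le_trans; rewrite -dualBB//; exact: xsB.2.
Qed.

Lemma dualB_zero : dualB (fun _ : E => 0 : R).
Proof. by split=> [a u v|v]; rewrite ?mulr0 ?addr0 ?normr0. Qed.

End DualBall.

Section VectorL1.
Context {d : measure_display} {Om : measurableType d} {R : realType}.
Context {E : completeNormedModType R}.
Variables (D : set (set Om)) (m : set Om -> E).
Hypotheses (cD : covering_ring D)
  (vm : forall xs, dualB xs -> countably_additive D (xs \o m)).
Implicit Types f g : Om -> R.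

Lemma inL1_signed xs f : dualB xs -> inL1 D m f -> signed_integrable D (xs \o m) f.
Proof. by move=> xsB [mf ff _]; split=> //; exact: ff. Qed.

Lemma inL1_measurable f : inL1 D m f -> measurable_fun setT f.
Proof. by case. Qed.

Lemma inL1_lin a f g : inL1 D m f -> inL1 D m g -> inL1 D m (fun x => a * f x + g x).
Proof.
move=> Lf Lg; have s xs (xsB : dualB xs) := signed_integrable_lin _ _ cD (vm _ xsB) a _ _
  (inL1_signed _ _ xsB Lf) (inL1_signed _ _ xsB Lg).
split; first exact: (s _ dualB_zero).1.
  by move=> xs xsB; exact: (s _ xsB).2.
move=> A mA; have [_ _ /(_ A mA)[u uf]] := Lf; have [_ _ /(_ A mA)[v vg]] := Lg.
exists (a *: u + v) => xs xsB; rewrite xsB.1 uf// vg// (sint_lin _ _ cD (vm _ xsB))//.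
- exact: inL1_signed.
- exact: inL1_signed.
Qed.

Lemma inL1_0 f : inL1 D m f -> inL1 D m (fun=> 0).
Proof.
move=> Lf; rewrite (_ : (fun=> 0) = fun x => -1 * f x + f x); first exact: inL1_lin.
by apply/funext => x; ring.
Qed.

Lemma inL1Z a f : inL1 D m f -> inL1 D m (fun x => a * f x).
Proof.
move=> Lf; rewrite (_ : (fun x => _) = fun x => a * f x + 0); last first.
  by apply/funext => x; rewrite addr0.
by apply: inL1_lin => //; exact: inL1_0 Lf.
Qed.

Lemma inL1_indic f A : inL1 D m f -> measurable A -> inL1 D m (fun x => f x * \1_A x).
Proof.
move=> Lf mA.
have s xs (xsB : dualB xs) : signed_integrable D (xs \o m) (fun x => f x * \1_A x).
  apply: (le_signed_integrable _ _ cD (vm _ xsB) _ _ (inL1_signed _ _ xsB Lf)) => [|x].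
    by apply: measurable_funM; [exact: inL1_measurable | exact: measurable_indic].
  by rewrite normrM indicE; case: (_ \in _); rewrite ?normr1 ?normr0 ?mulr1 ?mulr0.
split; first exact: (s _ dualB_zero).1.
  by move=> xs xsB; exact: (s _ xsB).2.
move=> B mB; have [_ _ /(_ _ (measurableI _ _ mB mA))[u uf]] := Lf.
by exists u => xs xsB; rewrite (sint_indic _ _ cD (vm _ xsB)) uf.
Qed.

(** Makes the supremum defining [nL1] finite. The vectors integrating [f] over measurable sets are
    bounded under each functional, hence in norm by some [M]; [absint_sint] costs the factor 3. *)
Lemma inL1_bounded f : inL1 D m f ->
  exists C : R, forall xs, dualB xs -> fine (absint D (xs \o m) f) <= C.
Proof.
move=> Lf.
pose F := [set e : E | exists2 A, measurable A &
   forall xs, dualB xs -> xs e = sint D (xs \o m) A f].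
have [xs xsB|M hM] := dualB_bounded F.
  exists (fine (absint D (xs \o m) f)) => e [A mA /(_ _ xsB) ->].
  by apply: (norm_sint_le _ _ cD (vm _ xsB)) => //; exact: inL1_signed.
exists (3 * M) => xs xsB.
have [A mA ->] := absint_sint _ _ cD (vm _ xsB) _ (inL1_signed _ _ xsB Lf).
have bd B : measurable B -> `|sint D (xs \o m) B f| <= M.
  move=> mB; have [_ _ /(_ _ mB)[e he]] := Lf.
  by rewrite -he//; apply: (le_trans (xsB.2 _)); apply: hM; exists B.
have := bd _ mA; have := bd _ (measurableT).
by rewrite !ler_norml => /andP[? ?] /andP[? ?]; lra.
Qed.

Lemma absint_le_nL1 f xs : inL1 D m f -> dualB xs ->
  fine (absint D (xs \o m) f) <= nL1 D m f.
Proof.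
move=> Lf xsB; have [C hC] := inL1_bounded _ Lf.
apply: ub_le_sup; last by exists xs.
by exists C => _ [ys ysB <-]; exact: hC.
Qed.

Lemma nL1_ge0 f : inL1 D m f -> 0 <= nL1 D m f.
Proof.
move=> Lf; apply: le_trans (absint_le_nL1 _ _ Lf dualB_zero).
by rewrite fine_ge0// (absint_ge0 _ _ cD (vm _ dualB_zero)).
Qed.

Lemma IintP f xs : inL1 D m f -> dualB xs ->
  xs (Iint D m f) = sint D (xs \o m) setT f.
Proof.
move=> Lf xsB; rewrite /Iint.
have [_ _ /(_ _ measurableT) hex] := Lf.
by have := @xgetPex _ 0 [set e | forall xs, dualB xs -> xs e = sint D (xs \o m) setT f] hex; apply.
Qed.

Lemma Iint_eq f e : inL1 D m f ->
  (forall xs, dualB xs -> xs e = sint D (xs \o m) setT f) -> Iint D m f = e.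
Proof. by move=> Lf he; apply: dualB_separates => xs xsB; rewrite IintP// he. Qed.

Lemma Iint_lin a f g : inL1 D m f -> inL1 D m g ->
  Iint D m (fun x => a * f x + g x) = a *: Iint D m f + Iint D m g.
Proof.
move=> Lf Lg; apply: Iint_eq; first exact: inL1_lin.
move=> xs xsB; rewrite xsB.1 !IintP// (sint_lin _ _ cD (vm _ xsB))//.
- exact: inL1_signed.
- exact: inL1_signed.
Qed.

Lemma norm_Iint_le f : inL1 D m f -> `|Iint D m f| <= nL1 D m f.
Proof.
move=> Lf; apply: norm_le_dualB => xs xsB.
apply: le_trans (absint_le_nL1 _ _ Lf xsB); rewrite IintP//.
apply: (le_trans (ler_norm _)); apply: (norm_sint_le _ _ cD (vm _ xsB)) => //.
exact: inL1_signed.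
Qed.

Lemma inL1_ae f g : inL1 D m f -> measurable_fun setT g ->
  ae (mnull D m) (fun x => f x = g x) -> inL1 D m g /\ Iint D m f = Iint D m g.
Proof.
move=> Lf mg [Z [[mZ Z0] fgZ]].
have fg x : ~ Z x -> f x = g x by move=> nZ; apply: contrapT => /fgZ.
have h xs (xsB : dualB xs) := absint_ae _ _ cD (vm _ xsB) f g Z
  (inL1_measurable _ Lf) mg mZ (Z0 _ xsB) fg.
have Lg : inL1 D m g.
  split=> // [xs xsB|A mA].
    by have := (inL1_signed _ _ xsB Lf).2; rewrite (h _ xsB).1.
  have [_ _ /(_ _ mA)[e he]] := Lf; exists e => xs xsB.
  by rewrite he// (h _ xsB).2.
split=> //; apply: Iint_eq => // xs xsB.
by rewrite IintP// (h _ xsB).2.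
Qed.

(** Closedness under convergence uniform relative to [g]: the integrals of [f_ n] over a fixed set
    form a Cauchy sequence in [E], since [inL1_bounded] for [g] makes the error uniform over the
    dual ball. *)
Lemma inL1_closed (f_ : nat -> Om -> R) f g : (forall n, inL1 D m (f_ n)) ->
  measurable_fun setT f -> inL1 D m g ->
  (forall n x, `|f_ n x - f x| <= 2^-1 ^+ n * g x) -> inL1 D m f.
Proof.
move=> Lf_ mf Lg fg.
have fsig xs (xsB : dualB xs) : signed_integrable D (xs \o m) f.
  have sg := inL1_signed _ _ xsB Lg.
  have sd : signed_integrable D (xs \o m) (fun x => f_ 0%N x - f x).
    apply: (le_signed_integrable _ _ cD (vm _ xsB) _ _ sg) => [|x].
      by apply: measurable_funB => //; exact: inL1_measurable.
    by apply: (le_trans (fg 0%N x)); rewrite expr0 mul1r ler_norm.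
  have := signed_integrable_lin _ _ cD (vm _ xsB) (-1) _ _ sd (inL1_signed _ _ xsB (Lf_ 0%N)).
  by congr signed_integrable; apply/funext => x; ring.
split=> // [xs xsB|A mA]; first exact: (fsig _ xsB).2.
have [C hC] := inL1_bounded _ Lg.
have /choice[e he] : forall n, exists e : E, forall xs, dualB xs ->
    xs e = sint D (xs \o m) A (f_ n).
  by move=> n; have [_ _ /(_ _ mA)] := Lf_ n.
have dsig n xs (xsB : dualB xs) : signed_integrable D (xs \o m) (fun x => -1 * f x + f_ n x).
  apply: (signed_integrable_lin _ _ cD (vm _ xsB)); first exact: fsig.
  exact: inL1_signed.
have est n xs (xsB : dualB xs) : `|xs (e n) - sint D (xs \o m) A f| <= 2^-1 ^+ n * C.
  rewrite he//; have := sint_lin _ _ cD (vm _ xsB) A (-1) _ _ mA (fsig _ xsB) (inL1_signed _ _ xsB (Lf_ n)).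
  rewrite mulN1r addrC => <-.
  apply: (le_trans (norm_sint_le _ _ cD (vm _ xsB) _ _ mA (dsig n _ xsB))).
  have p0 : 0 < 2^-1 ^+ n :> R by rewrite exprn_gt0// invr_gt0.
  have sg := inL1_signed _ _ xsB Lg.
  have sZ : signed_integrable D (xs \o m) (fun x => 2^-1 ^+ n * g x).
    by apply: inL1_signed => //; exact: inL1Z.
  apply: (@le_trans _ _ (fine (absint D (xs \o m) (fun x => 2^-1 ^+ n * g x)))).
    apply: fine_le.
    - by rewrite ge0_fin_numE ?(absint_ge0 _ _ cD (vm _ xsB))//; exact: (dsig n _ xsB).2.
    - by rewrite ge0_fin_numE ?(absint_ge0 _ _ cD (vm _ xsB))//; exact: sZ.2.
    - apply: (le_absint _ _ cD (vm _ xsB)); [exact: (dsig n _ xsB).1|exact: sZ.1|].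
      by move=> x; rewrite mulN1r addrC; apply: (le_trans (fg n x)); rewrite ler_norm.
  rewrite (absintZ _ _ cD (vm _ xsB)) ?(ltW p0)//; last exact: sg.1.
  by rewrite fineM// ?ler_pM2l ?hC// ge0_fin_numE ?(absint_ge0 _ _ cD (vm _ xsB))//; exact: sg.2.
have c0 : 2^-1 ^+ n * C @[n --> \oo] --> 0.
  rewrite -[0](mul0r C); apply: cvgMl; apply: cvg_expr.
  by rewrite ger0_norm ?invr_ge0// invf_lt1// ltr1n.
have ecv : cvgn e.
  apply: cauchy_cvg; apply: cauchy_exP => eps eps0.
  have eps2 : 0 < eps / 2 by rewrite divr_gt0.
  move/cvgrPdist_lt : c0 => /(_ _ eps2)[N _ hN].
  have bd n : (N <= n)%N -> 2^-1 ^+ n * C < eps / 2.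
    by move=> /hN /=; rewrite sub0r normrN => /ltr_normlW.
  exists (e N), N => // n /= Nn; rewrite -ball_normE/=.
  apply: (@le_lt_trans _ _ (2^-1 ^+ N * C + 2^-1 ^+ n * C)).
    (* Under each functional both vectors are compared with the integral of [f] itself; norming
       turns the uniform bound into one on the norm. *)
    apply: norm_le_dualB => xs xsB; rewrite dualBB//.
    have := est N _ xsB; have := est n _ xsB; rewrite !ler_norml.
    by move=> /andP[? ?] /andP[? ?]; lra.
  by have := bd _ (leqnn N); have := bd _ Nn; lra.
exists (limn e) => xs xsB.
have l1 : xs (e n) @[n --> \oo] --> xs (limn e) by exact: dualB_cvg.
apply: (cvg_unique _ l1) => //.
apply/cvgrPdist_le => eps eps0.
move/cvgrPdist_le : c0 => /(_ eps eps0); apply: filterS => n.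
rewrite sub0r normrN distrC => /ler_normlW h.
by apply: le_trans h; exact: est.
Qed.

(* Binary expansion of f relative to g: subtracting from the remainder r_k the
   multiple g / 2^k+1 wherever it fits halves the remainder, and the subtracted
   part belongs to L1 as a multiple of the restriction of g to a measurable set. *)
Lemma inL1_ideal_ge0 f g : measurable_fun setT f -> inL1 D m g ->
  (forall x, 0 <= f x <= g x) -> inL1 D m f.
Proof.
move=> mf Lg fg; have mg := inL1_measurable _ Lg.
pose A (r : Om -> R) k := [set x | 0 <= r x - 2^-1 ^+ k.+1 * g x].
pose r := fix r k : Om -> R := if k is j.+1 then
  fun x => r j x - 2^-1 ^+ j.+1 * (g x * \1_(A (r j) j) x) else f.
have mA h k : measurable_fun setT h -> measurable (A h k).
  move=> mh; pose u x := h x - 2^-1 ^+ k.+1 * g x.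
  have mu : measurable_fun setT u by apply: measurable_funB => //; exact: measurable_funM.
  rewrite (_ : A h k = u @^-1` `[0, +oo[); last first.
    by apply/seteqP; split=> x /=; rewrite in_itv/= andbT.
  by rewrite -[X in measurable X]setTI; exact: mu.
have mr k : measurable_fun setT (r k).
  elim: k => [//|k IH] /=; apply: measurable_funB => //.
  apply: measurable_funM => //; apply: measurable_funM => //.
  by apply: measurable_indic; exact: mA.
have r_bd k x : 0 <= r k x <= 2^-1 ^+ k * g x.
  elim: k => [|k /andP[r0 rg]]; first by rewrite expr0 mul1r.
  rewrite [r k.+1 x]/= indicE; set c := 2^-1 ^+ k.+1.
  have c2 : 2^-1 ^+ k = 2 * c by rewrite /c exprS; field.
  rewrite c2 in rg; have [Ax|nA] := pselect (A (r k) k x).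
    by rewrite mem_set//= mulr1; move: Ax; rewrite /A/= -/c; lra.
  rewrite memNset//= !mulr0 subr0 r0/=.
  by move/negP: nA; rewrite -ltNge -/c; lra.
apply: (inL1_closed (fun k x => f x - r k x) f g) => // [k|k x]; last first.
  by rewrite addrAC subrr add0r normrN; have /andP[r0 rg] := r_bd k x; rewrite ger0_norm.
elim: k => [|k IH].
  by under [fun x => _]eq_fun do rewrite subrr; exact: inL1_0 Lg.
rewrite (_ : (fun x => _) = fun x => 2^-1 ^+ k.+1 * (g x * \1_(A (r k) k) x) + (f x - r k x)).
  by apply: inL1_lin => //; apply: inL1_indic => //; exact: mA.
by apply/funext => x /=; ring.
Qed.

Lemma inL1_abs f : inL1 D m f -> inL1 D m (fun x => `|f x|).
Proof.
move=> Lf; have mf := inL1_measurable _ Lf.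
pose G := [set x | 0 <= f x].
have mG : measurable G.
  rewrite (_ : G = f @^-1` `[0, +oo[); last by apply/seteqP; split=> x /=; rewrite in_itv/= andbT.
  by rewrite -[X in measurable X]setTI; exact: mf.
rewrite (_ : (fun x => _) = fun x => 2 * (f x * \1_G x) + -1 * f x).
  by apply: inL1_lin; [exact: inL1_indic | exact: inL1Z].
apply/funext => x; rewrite indicE; have [Gx|nG] := pselect (G x).
  by rewrite mem_set// ger0_norm//=; ring.
rewrite memNset// ltr0_norm /=; first by ring.
by rewrite ltNge; exact/negP.
Qed.

(** The positive and negative parts of [f] lie between 0 and the absolute value of [g], where
    [inL1_ideal_ge0] applies. *)
Lemma inL1_ideal f g : measurable_fun setT f -> inL1 D m g ->
  (forall x, `|f x| <= `|g x|) -> inL1 D m f.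
Proof.
move=> mf Lg fg; have Lag := inL1_abs _ Lg.
have Lp : inL1 D m (fun x => Num.max (f x) 0).
  apply: (inL1_ideal_ge0 _ _ _ Lag) => [|x]; first exact: measurable_maxr.
  by rewrite le_max lexx orbT ge_max normr_ge0 andbT (le_trans (ler_norm _) (fg x)).
have Ln : inL1 D m (fun x => Num.max (- f x) 0).
  apply: (inL1_ideal_ge0 _ _ _ Lag) => [|x].
    by apply: measurable_maxr => //; exact: measurable_funN.
  rewrite le_max lexx orbT ge_max normr_ge0 andbT.
  by apply: le_trans (fg x); rewrite -normrN ler_norm.
rewrite (_ : f = fun x => -1 * Num.max (- f x) 0 + Num.max (f x) 0); first exact: inL1_lin.
apply/funext => x; rewrite !maxElt oppr_lt0; case: ltgtP; lra.
Qed.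

Lemma inL1_normr f : measurable_fun setT f -> inL1 D m (fun x => `|f x|) -> inL1 D m f.
Proof. by move=> mf Lf; apply: (inL1_ideal _ _ mf Lf) => x; rewrite normr_id. Qed.

End VectorL1.

(** * Quasi-Banach function spaces and their powers *)

Section Powers.
Context {R : realType}.
Implicit Types (a u v q : R).

Lemma powR_normVK u q : q != 0 -> `| `|u| `^ q | `^ q^-1 = `|u|.
Proof.
by move=> q0; rewrite ger0_norm ?powR_ge0// -powRrM mulfV// powRr1.
Qed.

(** The sum is at most twice the larger term. This covers all exponents [q >= 0] at once, without
    convexity. *)
Lemma powR_lin_le a u v q : 0 <= q ->
  `|a * u + v| `^ q <= 2 `^ q * `|a| `^ q * `|u| `^ q + 2 `^ q * `|v| `^ q.
Proof.
move=> q0; have p0 := powR_ge0.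
have mono x y : 0 <= x -> x <= y -> x `^ q <= y `^ q.
  by move=> x0 xy; apply: ge0_ler_powR; rewrite ?nnegrE// (le_trans x0).
have [auv|vau] := leP `|v| (`|a| * `|u|).
  apply: (@le_trans _ _ ((2 * (`|a| * `|u|)) `^ q)).
    apply: mono => //; apply: (le_trans (ler_normD _ _)); rewrite normrM; lra.
  by rewrite !powRM ?mulr_ge0// mulrA lerDl mulr_ge0//.
apply: (@le_trans _ _ ((2 * `|v|) `^ q)).
  by apply: mono => //; apply: (le_trans (ler_normD _ _)); rewrite normrM; lra.
by rewrite powRM// lerDr !mulr_ge0//.
Qed.

Lemma cvg_powR0 (w : nat -> R) q : 0 < q -> (forall n, 0 <= w n) ->
  w n @[n --> \oo] --> 0 -> w n `^ q @[n --> \oo] --> 0.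
Proof.
move=> q0 w0 wc; apply/cvgrPdist_le => e e0.
have e1 : 0 < e `^ q^-1 by rewrite powR_gt0.
move/cvgrPdist_le : wc => /(_ _ e1); apply: filterS => n.
rewrite !sub0r !normrN !ger0_norm ?powR_ge0// => h.
apply: (@le_trans _ _ ((e `^ q^-1) `^ q)).
  by apply: ge0_ler_powR; rewrite ?nnegrE ?powR_ge0// ltW.
by rewrite -powRrM mulVf ?gt_eqF// powRr1// ltW.
Qed.

End Powers.

(** * Ideals, order continuity and powers of function spaces *)

Section FunctionSpaces.
Context {d : measure_display} {Om : measurableType d} {R : realType}.
Implicit Types (Y Z : @qfs d Om R) (xi : {measure set Om -> \bar R}).

Lemma ae_all xi (P : Om -> Prop) : (forall x, P x) -> ae (null_of xi) P.
Proof.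
move=> h; exists set0; split; last by move=> x /=; apply.
by split; [exact: measurable0 | exact: measure0].
Qed.

Lemma qBfs_ideal_space xi Z : is_qBfs (null_of xi) Z -> ideal_space (qmem Z).
Proof.
move=> [Zm Z0 Zlin Zid _]; split=> // f g Zf mg fg.
by apply: (Zid f g) => //; exact: ae_all.
Qed.

Lemma qBfs_qnorm0 xi Z : is_qBfs (null_of xi) Z -> qnorm Z (fun=> 0) = 0.
Proof. by move=> [_ Z0 _ _ [[_ h] _ _ _ _]]; apply/h => //; exact: ae_all. Qed.

Lemma measurable_normr_powR (f : Om -> R) q : measurable_fun setT f ->
  measurable_fun setT (fun x => `|f x| `^ q).
Proof.
by move=> mf; apply: (measurableT_comp (measurable_powR q)); exact: measurableT_comp.
Qed.

Lemma qpow_ideal_space Z q : 0 < q -> ideal_space (qmem Z) -> ideal_space (qmem (qpow Z q)).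
Proof.
move=> q0 [Zm Zlin Zid]; split=> [f []//|a f g [mf Zf] [mg Zg]|f g [mf Zf] mg gf].
  have mh : measurable_fun setT (fun x => a * f x + g x).
    by apply: measurable_funD => //; exact: measurable_funM.
  split=> //; have Z0 : qmem Z (fun=> 0).
    by apply: (Zid _ _ Zf) => // x; rewrite normr0.
  (* The dominating function comes from [powR_lin_le]; the trailing [+ 0] gives it the shape of two
     nested uses of [Zlin]. *)
  apply: (Zid (fun x => 2 `^ q * `|a| `^ q * `|f x| `^ q +
                        (2 `^ q * `|g x| `^ q + 0))).
  - by apply: (Zlin) => //; exact: Zlin.
  - exact: measurable_normr_powR.
  - move=> x; rewrite addr0 ger0_norm ?powR_ge0//.
    by apply: le_trans (ler_norm _); apply: powR_lin_le; exact: ltW.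
split=> //; apply: (Zid _ _ Zf); first exact: measurable_normr_powR.
move=> x; rewrite !(ger0_norm (powR_ge0 _ _)).
by apply: ge0_ler_powR; rewrite ?nnegrE ?(ltW q0) ?gf.
Qed.

(** The consequence of [sigma_oc] that [represents] requires; it mentions no null sets and passes to
    powers. *)
Definition pointwise_order_continuous Y : Prop :=
  forall u : nat -> Om -> R, (forall n, qmem Y (u n)) ->
    (forall n x, u n.+1 x <= u n x) -> (forall x, u n x @[n --> \oo] --> 0) ->
    qnorm Y (u n) @[n --> \oo] --> 0.

Lemma sigma_oc_pointwise xi Z : sigma_oc (null_of xi) Z -> pointwise_order_continuous Z.
Proof. by move=> oc u Zu uS u0; apply: oc => //; exact: ae_all. Qed.

Lemma nonincreasing_cvg0_ge0 (w : nat -> R) : (forall n, w n.+1 <= w n) ->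
  w n @[n --> \oo] --> 0 -> forall n, 0 <= w n.
Proof.
move=> wS w0 n; apply: (cvgr_to_le w0); near=> k.
have nk : (n <= k)%N by near: k; exact: nbhs_infty_ge.
by have /nonincreasing_seqP ni := wS; exact: ni.
Unshelve. all: by end_near.
Qed.

Lemma qpow_pointwise_order_continuous Z q : 0 < q ->
  (forall f, qmem Z f -> 0 <= qnorm Z f) -> pointwise_order_continuous Z ->
  pointwise_order_continuous (qpow Z q).
Proof.
move=> q0 Z0 oc u Zu uS u0 /=.
have u_ge0 x n : 0 <= u n x by apply: (nonincreasing_cvg0_ge0 (fun n => u n x)).
apply: cvg_powR0 => [|n|]; rewrite ?invr_gt0//; first exact: Z0 (Zu n).2.
apply: oc => [n|n x|x]; first exact: (Zu n).2.
  by apply: ge0_ler_powR; rewrite ?nnegrE ?ger0_norm ?(ltW q0).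
apply: cvg_powR0 => //; rewrite -[0](@normr0 _ R); apply: cvg_norm; exact: u0.
Qed.

Lemma SigmaX_covering_ring (X : @qfs d Om R) : ideal_space (qmem X) -> sigma_prop X ->
  covering_ring (SigmaX X).
Proof.
move=> [Xm Xlin Xid] [K [mK [KT XK]]].
have DU A B : SigmaX X A -> SigmaX X B -> SigmaX X (A `|` B).
  move=> [mA XA] [mB XB]; split; first exact: measurableU.
  apply: (Xid (fun x => 1 * \1_A x + \1_B x)); first exact: Xlin.
    by apply: measurable_indic; exact: measurableU.
  move=> x; rewrite mul1r !indicE in_setU.
  by case: (x \in A); case: (x \in B); rewrite /= ?addr0 ?add0r// ger0_norm// ger0_norm//; lra.
split=> // [A []//|A B [mA XA] mB BA|].
  split=> //; apply: (Xid _ _ XA) => [|x]; first exact: measurable_indic.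
  rewrite !indicE; have [xB|xB] := boolP (x \in B); last by rewrite normr0.
  by rewrite (_ : x \in A = true)//; apply/mem_set/BA/set_mem.
(* Partial unions make the sets of the sigma-property increasing. *)
pose U := fix U n := if n is k.+1 then U k `|` K k.+1 else K 0%N.
exists U; split=> [n|n x|].
- by elim: n => [|n IH]; [split; [exact: mK | exact: XK] | apply: (DU) => //; split].
- by left.
- apply/seteqP; split=> // x _; have : setT x by []; rewrite -KT => -[n _ Kx].
  by exists n => //; case: n Kx => // n Kx; right.
Qed.

End FunctionSpaces.

(** * Order continuous operators factor through L^1 *)

Section Factorization.
Context {d : measure_display} {Om : measurableType d} {R : realType}.
Context {E : completeNormedModType R}.
Variables (xi : {measure set Om -> \bar R}) (Z : @qfs d Om R) (p : R)
  (St : (Om -> R) -> E) (D : set (set Om)) (m : set Om -> E).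
Hypotheses (qZ : is_qBfs (null_of xi) Z) (oZ : sigma_oc (null_of xi) Z) (p0 : 0 < p)
  (Stlin : lin_op (null_of xi) (qmem (qsum (null_of xi) (qpow Z p^-1) Z)) St)
  (Stcont : cont_on (qsum (null_of xi) (qpow Z p^-1) Z) St)
  (cD : covering_ring D)
  (DZ : forall A, D A -> qmem Z \1_A /\ m A = St \1_A).

Let W := qsum (null_of xi) (qpow Z p^-1) Z.
Let iZ := qBfs_ideal_space _ _ qZ.
Let pV0 : 0 < p^-1. Proof. by rewrite invr_gt0. Qed.
Let iZp := qpow_ideal_space _ _ pV0 iZ.
Let Z0 : qmem Z (fun=> 0). Proof. by case: qZ. Qed.
Let Zge0 f : qmem Z f -> 0 <= qnorm Z f.
Proof. by case: qZ => [_ _ _ _ [[h _] _ _ _ _]]; exact: h. Qed.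

Let qpow_zero : qmem (qpow Z p^-1) (fun=> 0) /\ qnorm (qpow Z p^-1) (fun=> 0) = 0.
Proof.
have E0 : (fun x : Om => `|0 : R| `^ p^-1) = fun=> 0.
  by apply/funext => x; rewrite normr0 powR0// gt_eqF.
rewrite /= E0 (qBfs_qnorm0 _ _ qZ) powR0 ?invrK ?gt_eqF//.
Qed.

Lemma qsum_left f : qmem (qpow Z p^-1) f -> qmem W f /\ qnorm W f <= qnorm (qpow Z p^-1) f.
Proof.
move=> Zf; have [mf _] := Zf; split.
  split=> //; exists f, (fun=> 0); split=> //; split=> //.
  by apply: ae_all => x; rewrite addr0.
apply: ge_inf.
  by exists 0 => _ [f1 [f2 [_ Zf2 _ ->]]]; rewrite addr_ge0 ?powR_ge0// Zge0.
exists f, (fun=> 0); split=> //; first by apply: ae_all => x; rewrite addr0.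
by rewrite (qBfs_qnorm0 _ _ qZ) addr0.
Qed.

Lemma qsum_right f : qmem Z f -> qmem W f /\ qnorm W f <= qnorm Z f.
Proof.
move=> Zf; have mf : measurable_fun setT f by case: iZ => [h _ _]; exact: h.
have [Zp0 n0] := qpow_zero; split.
  split=> //; exists (fun=> 0), f; split=> //; split=> //.
  by apply: ae_all => x; rewrite add0r.
apply: ge_inf.
  by exists 0 => _ [f1 [f2 [_ Zf2 _ ->]]]; rewrite addr_ge0 ?powR_ge0// Zge0.
exists (fun=> 0), f; split=> //; first by apply: ae_all => x; rewrite add0r.
by rewrite n0 add0r.
Qed.

Let W0 : qmem W (fun=> 0). Proof. exact: (qsum_right _ Z0).1. Qed.

Let St0 : St (fun=> 0) = 0.
Proof.
have := Stlin.1 (-1) _ _ W0 W0; rewrite scaleN1r addNr => <-.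
by congr St; apply/funext => x; ring.
Qed.

Section Summand.
Variable Y : @qfs d Om R.
Hypotheses (iY : ideal_space (qmem Y)) (oY : pointwise_order_continuous Y)
  (YW : forall f, qmem Y f -> qmem W f /\ qnorm W f <= qnorm Y f)
  (DY : forall A, D A -> qmem Y \1_A).

(** [Y] will be [Z] or its power [Z^(1/p)]. Both embed into the sum [W] without increasing the
    quasi-norm, so order continuity of [Y] and continuity of [St] at 0 give order continuity of the
    functional. *)
Lemma summand_represents xs : dualB xs ->
  represents (qmem Y) (fun f => xs (St f)) D (xs \o m).
Proof.
move=> xsB; split=> // [a f g Yf Yg|u Yu uS u0|A DA].
- by rewrite (Stlin.1 _ _ _ (YW _ Yf).1 (YW _ Yg).1) xsB.1.
- have qu := oY _ Yu uS u0.
  rewrite -(dualB0 _ xsB); apply: (dualB_cvg _ _ _ xsB).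
  apply/cvgrPdist_lt => e e0.
  have [del del0 hdel] := Stcont _ W0 _ e0.
  move/cvgrPdist_lt : qu => /(_ _ del0); apply: filterS => n.
  rewrite !sub0r !normrN => /ltr_normlW qn.
  have := hdel (u n) (YW _ (Yu n)).1; rewrite St0 subr0; apply.
  apply: le_lt_trans qn; apply: le_trans (YW _ (Yu n)).2.
  by rewrite (_ : (fun x => _) = u n)//; apply/funext => x; rewrite subr0.
- by split; [exact: DY | rewrite /= (DZ _ DA).2].
Qed.

Lemma summand_inL1 f : qmem Y f -> inL1 D m f /\ Iint D m f = St f.
Proof.
move=> Yf; have rep xs (xsB : dualB xs) := summand_represents _ xsB.
have Lf : inL1 D m f.
  split=> [|xs xsB|A mA]; first by case: iY => [h _ _]; exact: h.
    exact: (functional_var_lty _ _ _ _ (rep _ xsB)).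
  (* The integral of [f] over [A] is the operator applied to [f] cut off to [A]. *)
  exists (St (fun x => f x * \1_A x)) => xs xsB.
  by rewrite (functional_sint _ _ _ _ (rep _ xsB)).
split=> //; apply: dualB_separates => xs xsB.
have vm ys (ysB : dualB ys) : countably_additive D (ys \o m).
  exact: (functional_countably_additive _ _ _ _ (rep _ ysB)).
rewrite IintP// (functional_sint _ _ _ _ (rep _ xsB))//.
by congr (xs (St _)); apply/funext => x; rewrite indicE in_setT mulr1.
Qed.

End Summand.

Let Z_oc := sigma_oc_pointwise _ _ oZ.

Lemma factor_countably_additive xs : dualB xs -> countably_additive D (xs \o m).
Proof.
move=> xsB; apply: (functional_countably_additive (qmem Z) (fun f => xs (St f))).
apply: summand_represents => //; first exact: qsum_right.
by move=> A DA; have [] := DZ _ DA.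
Qed.

(** [summand_inL1] is used twice: with [Y = Z] for [f], and with [Y = Z^(1/p)] for the [p]-th power
    of the absolute value of [f], which belongs to that space because its [1/p]-th power is the
    absolute value of [f]. *)
Lemma factor_inL1 f : qmem Z f ->
  [/\ inL1 D m f, inL1 D m (fun x => `|f x| `^ p) & Iint D m f = St f].
Proof.
move=> Zf; have DZ' A : D A -> qmem Z \1_A by move=> DA; have [] := DZ _ DA.
have [Lf ->] := summand_inL1 Z iZ Z_oc qsum_right DZ' _ Zf.
have mf : measurable_fun setT f by case: iZ => [h _ _]; exact: h.
split=> //.
have DZp A : D A -> qmem (qpow Z p^-1) \1_A.
  move=> DA; have [ZA _] := DZ _ DA; split.
    by case: iZ => [h _ _]; exact: h.
  rewrite (_ : (fun x => _) = \1_A)//; apply/funext => x; rewrite indicE.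
  by case: (_ \in _); rewrite ?normr1 ?normr0 ?powR1 ?powR0// gt_eqF.
have := summand_inL1 _ iZp (qpow_pointwise_order_continuous _ _ pV0 Zge0 Z_oc) qsum_left DZp
  (fun x => `|f x| `^ p).
case=> //; split; first exact: measurable_normr_powR.
case: iZ => [_ _ Zid]; apply: (Zid _ _ Zf).
  by apply: measurable_normr_powR; exact: measurable_normr_powR.
by move=> x; rewrite powR_normVK ?gt_eqF// normr_id.
Qed.

End Factorization.

(** * The integration operator and optimality *)

Section IntegrationOperator.
Context {d : measure_display} {Om : measurableType d} {R : realType}.
Context {E : completeNormedModType R}.
Variables (D : set (set Om)) (m : set Om -> E) (p : R).
Hypotheses (cD : covering_ring D)
  (vm : forall xs, dualB xs -> countably_additive D (xs \o m)) (p0 : 0 < p).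
Implicit Types f g : Om -> R.

Let Y : @qfs d Om R := LpL1 D m p.
Let N : set (set Om) := mnull D m.
Let W : @qfs d Om R := qsum N (qpow Y p^-1) Y.

Lemma mnullU A B : N A -> N B -> N (A `|` B).
Proof.
move=> [mA A0] [mB B0]; split; first exact: measurableU.
move=> xs xsB; have [P [P' [_ _ VE]]] := var_measure_add _ _ cD (vm _ xsB).
have null C : measurable C -> var D (xs \o m) C = 0%E -> (measure_add P P').-negligible C.
  by move=> mC; rewrite VE => C0; apply/negligibleP.
rewrite VE; apply/negligibleP; first exact: measurableU.
by apply: negligibleU; apply: null => //; [exact: A0 | exact: B0].
Qed.

Lemma mnull_ae2 (P Q S : Om -> Prop) : ae N P -> ae N Q ->
  (forall x, P x -> Q x -> S x) -> ae N S.
Proof.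
move=> [A [NA PA]] [B [NB QB]] PQS; exists (A `|` B); split; first exact: mnullU.
move=> x nS; apply: contrapT => nAB; apply: nS; apply: PQS.
  by apply: contrapT => nP; apply: nAB; left; exact: PA.
by apply: contrapT => nQ; apply: nAB; right; exact: QB.
Qed.

Lemma inL1_powR_lin a f g q : 0 <= q -> measurable_fun setT f -> measurable_fun setT g ->
  inL1 D m (fun x => `|f x| `^ q) -> inL1 D m (fun x => `|g x| `^ q) ->
  inL1 D m (fun x => `|a * f x + g x| `^ q).
Proof.
move=> q0 mf mg Lf Lg.
have Lh := inL1_lin _ _ cD vm (2 `^ q * `|a| `^ q) _ _ Lf (inL1Z _ _ cD vm (2 `^ q) _ Lg).
apply: (inL1_ideal _ _ cD vm _ _ _ Lh) => [|x].
  by apply: measurable_normr_powR; apply: measurable_funD => //; exact: measurable_funM.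
by rewrite (ger0_norm (powR_ge0 _ _)); apply: le_trans (ler_norm _); exact: powR_lin_le.
Qed.

Let powRVK f : (fun x => `| `|f x| `^ p^-1 | `^ p) = (fun x => `|f x|).
Proof. by apply/funext => x; rewrite -[X in _ `^ X](invrK p) powR_normVK// invr_eq0 gt_eqF. Qed.

(** The [1/p]-th power of L^p cap L^1 is L^1 cap L^(1/p); in particular it lies in L^1. *)
Lemma qpow_LpL1P f : qmem (qpow Y p^-1) f <->
  [/\ measurable_fun setT f, inL1 D m f & inL1 D m (fun x => `|f x| `^ p^-1)].
Proof.
split=> [[mf [[_ L1] L2]]|[mf L1 L2]].
  by split=> //; move: L1; rewrite powRVK => /(inL1_normr _ _ cD vm _ mf).
split=> //; split=> //; split; first exact: measurable_normr_powR.
by rewrite powRVK; exact: inL1_abs.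
Qed.

(** The L^p part of the maximum, evaluated at the [1/p]-th power of the absolute value of [f] and
    raised to the power [p], is exactly the L^1 norm of [f]. *)
Lemma nL1_le_qpow f : qmem (qpow Y p^-1) f -> nL1 D m f <= qnorm (qpow Y p^-1) f.
Proof.
move=> Yf; have [_ Lf _] := (qpow_LpL1P _).1 Yf.
have E0 : nL1 D m (fun x => `|f x|) = nL1 D m f.
  rewrite /nL1; congr sup; apply/seteqP; split=> _ [xs xsB <-]; exists xs => //;
  by congr fine; congr integral; apply/funext => x; rewrite normr_id.
have n0 := nL1_ge0 _ _ cD vm _ Lf.
rewrite /= powRVK E0 invrK.
apply: (@le_trans _ _ ((nL1 D m f `^ p^-1) `^ p)).
  by rewrite -powRrM mulVf ?gt_eqF// powRr1.
apply: ge0_ler_powR; rewrite ?nnegrE ?(ltW p0) ?powR_ge0//.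
  by rewrite le_max powR_ge0.
by rewrite le_max lexx.
Qed.

Lemma nL1_le_LpL1 f : nL1 D m f <= qnorm Y f.
Proof. by rewrite /= le_max lexx orbT. Qed.

Lemma qsum_decomp f : qmem W f -> exists f1 f2, [/\ qmem (qpow Y p^-1) f1, qmem Y f2,
  ae N (fun x => f x = f1 x + f2 x), inL1 D m f1 & inL1 D m f2].
Proof.
move=> [mf [f1 [f2 [Yf1 [Yf2 ff]]]]]; exists f1, f2; split=> //.
  by have [] := (qpow_LpL1P _).1 Yf1.
by case: Yf2.
Qed.

Lemma decomp_inL1 f f1 f2 : measurable_fun setT f -> inL1 D m f1 -> inL1 D m f2 ->
  ae N (fun x => f x = f1 x + f2 x) ->
  inL1 D m f /\ Iint D m f = Iint D m f1 + Iint D m f2.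
Proof.
move=> mf L1 L2 [Z [NZ fZ]].
have := inL1_ae _ _ cD vm _ f (inL1_lin _ _ cD vm 1 _ _ L1 L2) mf.
rewrite (Iint_lin _ _ cD vm)// scale1r => h.
have /h[Lf <-] // : ae (mnull D m) (fun x => 1 * f1 x + f2 x = f x).
exists Z; split=> // x /= nx; apply: fZ => /= fx; apply: nx.
by rewrite fx mul1r.
Qed.

Lemma qsum_inL1 f : qmem W f -> inL1 D m f.
Proof.
move=> Wf; have [f1 [f2 [_ _ ff L1 L2]]] := qsum_decomp _ Wf.
exact: (decomp_inL1 _ _ _ Wf.1 L1 L2 ff).1.
Qed.

Lemma LpL1_lin a f g : qmem Y f -> qmem Y g -> qmem Y (fun x => a * f x + g x).
Proof.
move=> [[mf Lpf] Lf] [[mg Lpg] Lg]; split; last exact: inL1_lin.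
split; last by apply: inL1_powR_lin => //; exact: ltW.
by apply: measurable_funD => //; exact: measurable_funM.
Qed.

Lemma qpow_LpL1_lin a f g : qmem (qpow Y p^-1) f -> qmem (qpow Y p^-1) g ->
  qmem (qpow Y p^-1) (fun x => a * f x + g x).
Proof.
move=> /qpow_LpL1P[mf Lf Lpf] /qpow_LpL1P[mg Lg Lpg]; apply/qpow_LpL1P; split.
- by apply: measurable_funD => //; exact: measurable_funM.
- exact: inL1_lin.
- by apply: inL1_powR_lin => //; rewrite invr_ge0 ltW.
Qed.

(** Every decomposition of [f] bounds the integral by the sum of the two quasi-norms; then the
    infimum is taken. *)
Lemma norm_Iint_le_qsum f : qmem W f -> `|Iint D m f| <= qnorm W f.
Proof.
move=> Wf; apply: lb_le_inf.
  have [mf [f1 [f2 [h1 [h2 h3]]]]] := Wf.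
  by exists (qnorm (qpow Y p^-1) f1 + qnorm Y f2), f1, f2.
move=> _ [f1 [f2 [Yf1 Yf2 ff ->]]].
have [_ L1 _] := (qpow_LpL1P _).1 Yf1; have L2 : inL1 D m f2 by case: Yf2.
rewrite (decomp_inL1 _ _ _ Wf.1 L1 L2 ff).2.
apply: (le_trans (ler_normD _ _)); apply: lerD.
  by apply: (le_trans (norm_Iint_le _ _ cD vm _ L1)); exact: nL1_le_qpow.
by apply: (le_trans (norm_Iint_le _ _ cD vm _ L2)); exact: nL1_le_LpL1.
Qed.

Lemma qsum_sub f g : qmem W f -> qmem W g -> qmem W (fun x => f x - g x).
Proof.
move=> [mf [f1 [f2 [Yf1 [Yf2 ff]]]]] [mg [g1 [g2 [Yg1 [Yg2 gg]]]]].
split; first exact: measurable_funB.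
exists (fun x => -1 * g1 x + f1 x), (fun x => -1 * g2 x + f2 x).
split; first exact: qpow_LpL1_lin.
split; first exact: LpL1_lin.
by apply: (mnull_ae2 _ _ _ ff gg) => x -> ->; ring.
Qed.

(** The integration operator is its own extension, since the sum space is contained in L^1 of
    [m]. *)
Lemma Iint_pfact : pfact N Y p (Iint D m).
Proof.
exists (Iint D m); split=> //.
  split=> [a f g Wf Wg|f g Wf Wg fg].
    by rewrite (Iint_lin _ _ cD vm)//; exact: qsum_inL1.
  exact: (inL1_ae _ _ cD vm _ _ (qsum_inL1 _ Wf) Wg.1 fg).2.
(* The bound of [norm_Iint_le_qsum] has constant 1, so [e] itself serves as [del]. *)
move=> g Wg e e0; exists e => // f Wf.
apply: le_lt_trans.
have -> : Iint D m f - Iint D m g = Iint D m (fun x => f x - g x).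
  have := Iint_lin _ _ cD vm (-1) _ _ (qsum_inL1 _ Wg) (qsum_inL1 _ Wf).
  rewrite scaleN1r addrC => <-; congr Iint; apply/funext => x; ring.
by apply: norm_Iint_le_qsum; exact: qsum_sub.
Qed.

End IntegrationOperator.

(** * Factorizations of [T] through another function space *)

Section Optimality.
Context {d : measure_display} {Om : measurableType d} {R : realType}.
Context {E : completeNormedModType R}.
Variables (X Z : @qfs d Om R) (p : R) (T S : (Om -> R) -> E).
Variable xi : {measure set Om -> \bar R}.
Hypotheses (cX : covering_ring (SigmaX X)) (p0 : 0 < p)
  (qZ : is_qBfs (null_of xi) Z) (oZ : sigma_oc (null_of xi) Z)
  (XZ : forall f, qmem X f -> qmem Z f)
  (lS : lin_op (null_of xi) (qmem Z) S)
  (TS : forall f, qmem X f -> T f = S f)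
  (fS : pfact (null_of xi) Z p S).

Let D := SigmaX X.
Let m := mT X T.

Lemma factored_countably_additive xs : dualB xs -> countably_additive D (xs \o m).
Proof.
have [St [lSt cSt StS]] := fS.
apply: (factor_countably_additive xi Z p St D m) => // A [mA XA].
by split; [exact: XZ | rewrite /m /mT TS// StS//; exact: XZ].
Qed.

(** The indicator of a subset of a null set of [xi] equals 0 almost everywhere, so [S], and with it
    [m], vanishes there. *)
Lemma factored_mnull A : null_of xi A -> mnull D m A.
Proof.
move=> [mA A0]; split=> // xs xsB.
have [_ Z0 _ _ _] := qZ.
have S0 : S (fun=> 0) = 0.
  have := lS.1 (-1) _ _ Z0 Z0; rewrite scaleN1r addNr => <-.
  by congr S; apply/funext => x; ring.
have m0 B : D B -> B `<=` A -> m B = 0.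
  move=> [mB XB] BA; rewrite /m /mT TS// -S0; apply: lS.2 => //; first exact: XZ.
  exists A; split=> // x /= nx; apply: contrapT => nA; apply: nx.
  by rewrite indicE memNset// => /BA.
apply/eqP; rewrite eq_le; apply/andP; split.
  apply: ge_ereal_sup => _ [n [B [DB _ ->]]].
  rewrite big1// => i _; have [DBi BA] := DB i.
  by rewrite /= m0// dualB0// normr0.
(* The empty family provides the value 0. *)
apply: ereal_sup_ubound; exists 0%N, (fun=> set0).
by split=> [[]//|[]//|]; rewrite big_ord0.
Qed.

(** Serves both halves of the theorem: [Z = X] with [S = T] is the factorization of [T], and a
    general [Z] is optimality. *)
Lemma factored_wd :
  wd (null_of xi) Z (mnull D m) (LpL1 D m p) /\ (forall f, qmem Z f -> S f = Iint D m f).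
Proof.
have [St [lSt cSt StS]] := fS.
have DZ A : D A -> qmem Z \1_A /\ m A = St \1_A.
  by move=> [mA XA]; split; [exact: XZ | rewrite /m /mT TS// StS//; exact: XZ].
have h f (Zf : qmem Z f) := factor_inL1 xi Z p St D m qZ oZ p0 lSt cSt cX DZ _ Zf.
split; last by move=> f Zf; have [_ _ ->] := h _ Zf; rewrite StS.
split=> [A|f Zf]; first exact: factored_mnull.
have [Lf Lpf _] := h _ Zf.
by split=> //; split=> //; exact: inL1_measurable Lf.
Qed.

End Optimality.

Theorem theorem6p2 (R : realType) (d : measure_display) (Om : measurableType d)
  (mu : {measure set Om -> \bar R}) (E : completeNormedModType R)
  (X : @qfs d Om R) (p : R) (T : (Om -> R) -> E) :
  is_qBfs (null_of mu) X -> sigma_oc (null_of mu) X -> sigma_prop X ->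
  0 < p ->
  lin_op (null_of mu) (qmem X) T ->
  pfact (null_of mu) X p T ->
  [/\ wd (null_of mu) X (mnull (SigmaX X) (mT X T)) (LpL1 (SigmaX X) (mT X T) p),
      (forall f, qmem X f -> T f = Iint (SigmaX X) (mT X T) f),
      pfact (mnull (SigmaX X) (mT X T)) (LpL1 (SigmaX X) (mT X T) p) p
            (Iint (SigmaX X) (mT X T)) &
      forall (xi : {measure set Om -> \bar R}) (Z : @qfs d Om R) (S : (Om -> R) -> E),
        (forall A, null_of mu A -> null_of xi A) ->
        is_qBfs (null_of xi) Z -> sigma_oc (null_of xi) Z ->
        wd (null_of mu) X (null_of xi) Z ->
        lin_op (null_of xi) (qmem Z) S ->
        (forall f, qmem X f -> T f = S f) ->
        pfact (null_of xi) Z p S ->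
        wd (null_of xi) Z (mnull (SigmaX X) (mT X T)) (LpL1 (SigmaX X) (mT X T) p) /\
        (forall f, qmem Z f -> S f = Iint (SigmaX X) (mT X T) f)].
Proof.
move=> qX oX sX p0 lT fT.
have cX := SigmaX_covering_ring _ (qBfs_ideal_space _ _ qX) sX.
(* The trivial factorization of [T] through [X] itself, with [xi] equal to [mu]. *)
have [wX TI] := factored_wd X X p T T mu cX p0 qX oX (fun _ h => h) lT (fun _ _ => erefl) fT.
split=> //.
  apply: Iint_pfact => // xs xsB.
  by apply: (factored_countably_additive X X p T T mu).
by move=> xi Z S _ qZ oZ [_ XZ] lS TS fS; exact: (factored_wd X Z p T S xi).
Qed.
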